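(* For every fixed $\delta\in(0,1)$ there is a constant $C>0$ (depending only on $\delta$) such that the following holds. Let $\epsilon\in(0,1)$, let $m>c\ge1$ and $n>r\ge1$ be integers. One can choose positive integers $s_c\le C(c/\epsilon+c\log c)$ and $s_r\le C(r/\epsilon+r\log r)$, depending only on $c,r,\epsilon,\delta$, such that for all $A\in\mathbb{R}^{m\times n}$, all $M\in\mathbb{R}^{m\times c}$ of full column rank and all $N\in\mathbb{R}^{r\times n}$ of full row rank the following is true. Let $S_M\in\mathbb{R}^{s_c\times m}$ be the leverage-score sketching matrix for $M$ and $S_N\in\mathbb{R}^{s_r\times n}$ the leverage-score sketching matrix for $N^T$, chosen independently. Let $X^*=M^\dagger A N^\dagger$, a minimizer of $\|A-MXN\|_F$ over $X\in\mathbb{R}^{c\times r}$, and $\hat X=(S_M M)^\dagger S_M A S_N^T (N S_N^T)^\dagger$. Then with probability at least $1-\delta$, $$\|A-M\hat X N\|_F\le(1+\epsilon)\,\|A-MX^*N\|_F,$$ and $\hat X$ can be constructed with computational complexity $$O\Big(\mathrm{nnz}(M)+\mathrm{nnz}(N)+\tfrac{c^2r+cr^2}{\epsilon^2}+\tfrac{(c^2r+cr^2)\log(cr)}{\epsilon}+\tfrac{c^3+r^3}{\epsilon}+(c^2r+cr^2)\log c\,\log r+c^3\log c+r^3\log r\Big),$$ where the implied constant depends only on $\delta$.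
   Context: $\|\cdot\|_F$ is the Frobenius norm, $Y^\dagger$ is the Moore-Penrose pseudoinverse of $Y$, and $\mathrm{nnz}(Y)$ is the number of nonzero entries of $Y$. Computational complexity counts arithmetic operations. Leverage-score sketching matrix: let $Y\in\mathbb{R}^{p\times k}$ with $p>k$ have full column rank, let $V\in\mathbb{R}^{p\times k}$ have columns forming an orthonormal basis of the column space of $Y$, let $v_{i,*}$ be the $i$-th row of $V$, and put $\ell_i=\|v_{i,*}\|_2^2/k$ for $1\le i\le p$ (the leverage scores of $Y$, which sum to $1$). Given a positive integer $s$, construct $\Omega\in\mathbb{R}^{p\times s}$ and diagonal $D\in\mathbb{R}^{s\times s}$ as follows: for every $j=1,\dots,s$, independently and with replacement, pick an index $i\in\{1,\dots,p\}$ with probability $\ell_i$ and set $\Omega_{ij}=1$ and $D_{jj}=1/\sqrt{\ell_i s}$; all other entries are $0$. The $s\times p$ leverage-score sketching matrix for $Y$ is $(\Omega D)^T$. *)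

(* Defs.v *)
From HB Require Import structures.
From mathcomp Require Import all_boot all_order all_algebra.
From mathcomp Require Import boolp classical_sets reals exp.

Set Implicit Arguments.
Unset Strict Implicit.
Unset Printing Implicit Defensive.

Import Order.TTheory GRing.Theory Num.Theory.
Local Open Scope ring_scope.

Section MatrixNotions.
Variable R : realType.

Definition frob m n (A : 'M[R]_(m, n)) : R :=
  Num.sqrt (\sum_i \sum_j A i j ^+ 2).

Definition nnz m n (A : 'M[R]_(m, n)) : nat :=
  #|[set ij : 'I_m * 'I_n | A ij.1 ij.2 != 0]|.

Definition penrose m n (A : 'M[R]_(m, n)) (B : 'M[R]_(n, m)) : Prop :=
  [/\ A *m B *m A = A,
      B *m A *m B = B,
      (A *m B)^T = A *m B &
      (B *m A)^T = B *m A].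

(* The Moore-Penrose pseudoinverse; [mxalgebra.pinvmx] is only some partial
   inverse.  The default value 0 is never used, see [pinvP]. *)
Definition pinv m n (A : 'M[R]_(m, n)) : 'M[R]_(n, m) :=
  xget 0 [set B | penrose A B]%classic.

Lemma mulmx_tr_eq0 m n (A : 'M[R]_(m, n)) : A *m A^T = 0 -> A = 0.
Proof.
move=> AA0; apply/matrixP => i j; rewrite mxE.
have := congr1 (fun B : 'M_m => B i i) AA0; rewrite !mxE => S0.
have /psumr_eq0P : forall k, true -> 0 <= A i k * A^T k i.
  by move=> k _; rewrite mxE -expr2 sqr_ge0.
by move/(_ S0 j isT)/eqP; rewrite mxE mulf_eq0 orbb => /eqP.
Qed.

Lemma gram_unit k n (F : 'M[R]_(k, n)) : row_free F -> F *m F^T \in unitmx.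
Proof.
move=> Ffree; rewrite -row_free_unit -kermx_eq0; apply/eqP.
set K := kermx _; apply: (row_free_inj Ffree); rewrite mul0mx.
apply: mulmx_tr_eq0.
by rewrite trmx_mul mulmxA -(mulmxA K) mulmx_ker mul0mx.
Qed.

Lemma penrose_mul m k n (C : 'M[R]_(m, k)) (F : 'M[R]_(k, n)) :
    C^T *m C \in unitmx -> F *m F^T \in unitmx ->
  penrose (C *m F) (F^T *m invmx (F *m F^T) *m invmx (C^T *m C) *m C^T).
Proof.
move=> uC uF; set G := invmx (F *m F^T); set H := invmx (C^T *m C).
have GT : G^T = G by rewrite /G trmx_inv trmx_mul trmxK.
have HT : H^T = H by rewrite /H trmx_inv trmx_mul trmxK.
set B := F^T *m G *m H *m C^T.
have AB : C *m F *m B = C *m H *m C^T.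
  by rewrite /B !mulmxA -(mulmxA C F) -(mulmxA C _ G) mulmxV // mulmx1.
have BA : B *m (C *m F) = F^T *m G *m F.
  by rewrite /B !mulmxA -(mulmxA _ C^T C) -(mulmxA _ H) mulVmx // mulmx1.
split.
- by rewrite AB !mulmxA -(mulmxA _ C^T C) -(mulmxA _ H) mulVmx // mulmx1.
- by rewrite BA /B !mulmxA -(mulmxA _ F F^T) -(mulmxA _ _ G) mulmxV // mulmx1.
- by rewrite AB !trmx_mul trmxK HT mulmxA.
- by rewrite BA !trmx_mul trmxK GT mulmxA.
Qed.

Lemma penrose_exists m n (A : 'M[R]_(m, n)) : exists B, penrose A B.
Proof.
rewrite -(mulmx_base A); eexists; apply: penrose_mul.
  rewrite -{2}[col_base A]trmxK; apply: gram_unit.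
  by rewrite /row_free mxrank_tr; apply: col_base_full.
by apply/gram_unit/row_base_free.
Qed.

Lemma pinvP m n (A : 'M[R]_(m, n)) : penrose A (pinv A).
Proof. by rewrite /pinv; case: xgetP => // ?; case: (penrose_exists A). Qed.

Lemma penrose_unique m n (A : 'M[R]_(m, n)) B1 B2 :
  penrose A B1 -> penrose A B2 -> B1 = B2.
Proof.
move=> [a1 b1 c1 d1] [a2 b2 c2 d2].
have e1 : A *m B1 = A *m B2.
  by rewrite -c1 -{1}a2 -(mulmxA (A *m B2)) trmx_mul c1 c2 mulmxA a1.
have e2 : B1 *m A = B2 *m A.
  by rewrite -d1 -{1}a2 -(mulmxA A) mulmxA trmx_mul d2 d1 -mulmxA (mulmxA A) a1.
by rewrite -b1 e2 -mulmxA e1 mulmxA b2.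
Qed.

End MatrixNotions.

Section LeverageSketch.
Variable R : realType.

(* The column space of [Y] is the row space of [Y^T]. *)
Definition orthonormal_colbasis p k (Y V : 'M[R]_(p, k)) : Prop :=
  V^T *m V = 1%:M /\ (V^T :=: Y^T)%MS.

Definition leverage p k (V : 'M[R]_(p, k)) (i : 'I_p) : R :=
  (\sum_j V i j ^+ 2) / k%:R.

(* An outcome of the [s] picks: [w j] is the index picked at step [j]. *)
Definition picks p s := {ffun 'I_s -> 'I_p}.

Definition pick_prob p k s (V : 'M[R]_(p, k)) (w : picks p s) : R :=
  \prod_j leverage V (w j).

Definition sketch_Omega p s (w : picks p s) : 'M[R]_(p, s) :=
  \matrix_(i, j) (w j == i)%:R.

Definition sketch_D p k s (V : 'M[R]_(p, k)) (w : picks p s) : 'M[R]_s :=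
  diag_mx (\row_j (1 / Num.sqrt (leverage V (w j) * s%:R))).

Definition sketch p k s (V : 'M[R]_(p, k)) (w : picks p s) : 'M[R]_(s, p) :=
  (sketch_Omega w *m sketch_D V w)^T.

(* Probability of an event on two independent families of picks. *)
Definition Pr2 p1 k1 s1 (V1 : 'M[R]_(p1, k1)) p2 k2 s2 (V2 : 'M[R]_(p2, k2))
    (E : picks p1 s1 -> picks p2 s2 -> bool) : R :=
  \sum_(w : picks p1 s1 * picks p2 s2 | E w.1 w.2)
    pick_prob V1 w.1 * pick_prob V2 w.2.

End LeverageSketch.

Section GMR.
Variable R : realType.
Variables m n c r : nat.

Definition residual (A : 'M[R]_(m, n)) (M : 'M[R]_(m, c)) (N : 'M[R]_(r, n))
    (X : 'M[R]_(c, r)) : R :=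
  frob (A - M *m X *m N).

Definition Xstar (A : 'M[R]_(m, n)) (M : 'M[R]_(m, c)) (N : 'M[R]_(r, n)) :
    'M[R]_(c, r) :=
  pinv M *m A *m pinv N.

Definition Xhat sc sr (SM : 'M[R]_(sc, m)) (SN : 'M[R]_(sr, n))
    (A : 'M[R]_(m, n)) (M : 'M[R]_(m, c)) (N : 'M[R]_(r, n)) : 'M[R]_(c, r) :=
  pinv (SM *m M) *m SM *m A *m SN^T *m pinv (N *m SN^T).

End GMR.

(* Algebraic computation trees.  A tree is fixed before its input is known;
   arithmetic operations and equality tests each cost one unit, while reading
   an input coordinate (of type [I]), a previous result or a natural constant
   is free.  [Reg i] is the [i]-th result computed on the current branch. *)
Inductive arith := Add | Sub | Mul | Div.

Inductive operand (I : Type) :=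
  | In of I
  | Reg of nat
  | Cst of nat.
Arguments Reg {I}.
Arguments Cst {I}.

Inductive ctree (I : Type) (c r : nat) :=
  | Return of 'M[operand I]_(c, r)
  | Compute of arith & operand I & operand I & ctree I c r
  | TestEq of operand I & operand I & ctree I c r & ctree I c r.

Section Run.
Variables (R : realType) (I : Type) (c r : nat) (input : I -> R).

Definition operand_val (regs : seq R) (a : operand I) : R :=
  match a with
  | In i => input i
  | Reg i => regs`_i
  | Cst k => k%:R
  end.

(* Division by zero is an error. *)
Definition arith_val (o : arith) (x y : R) : option R :=
  match o with
  | Add => Some (x + y)
  | Sub => Some (x - y)
  | Mul => Some (x * y)
  | Div => if y == 0 then None else Some (x / y)
  end.

Definition tick (res : option ('M[R]_(c, r) * nat)) :=
  omap (fun p => (p.1, p.2.+1)) res.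

(* The output and the number of units spent, or [None] after an error. *)
Fixpoint run (t : ctree I c r) (regs : seq R) : option ('M[R]_(c, r) * nat) :=
  match t with
  | Return X => Some (map_mx (operand_val regs) X, 0)
  | Compute o a b t' =>
      if arith_val o (operand_val regs a) (operand_val regs b) is Some v
      then tick (run t' (rcons regs v)) else None
  | TestEq a b t1 t2 =>
      tick (if operand_val regs a == operand_val regs b
            then run t1 regs else run t2 regs)
  end.

End Run.

(* Addresses of the rows of a [p]-row input: [inl i] is row [i] and [inr j] is
   the row picked at step [j], so a tree can follow the picks without having
   been built from them. *)
Definition address p s := ('I_p + 'I_s)%type.

Definition resolve p s (w : picks p s) (a : address p s) : 'I_p :=
  match a with inl i => i | inr j => w j end.

Inductive gmr_coord (m n c r sc sr : nat) :=
  | InA of address m sc & address n sr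
  | InM of address m sc & 'I_c
  | InN of 'I_r & address n sr
  | InSM of 'I_sc & address m sc
  | InSN of 'I_sr & address n sr.
Arguments InA {m n c r sc sr}.
Arguments InM {m n c r sc sr}.
Arguments InN {m n c r sc sr}.
Arguments InSM {m n c r sc sr}.
Arguments InSN {m n c r sc sr}.

Definition gmr_input (R : realType) m n c r sc sr
    (A : 'M[R]_(m, n)) (M : 'M[R]_(m, c)) (N : 'M[R]_(r, n))
    (SM : 'M[R]_(sc, m)) (SN : 'M[R]_(sr, n)) (wM : picks m sc) (wN : picks n sr)
    (x : gmr_coord m n c r sc sr) : R :=
  match x with
  | InA i j => A (resolve wM i) (resolve wN j)
  | InM i k => M (resolve wM i) k
  | InN k j => N k (resolve wN j)
  | InSM l i => SM l (resolve wM i)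
  | InSN l j => SN l (resolve wN j)
  end.

Definition gmr_cost (R : realType) (eps : R) (c r nnzM nnzN : nat) : R :=
  let cr : R := (c ^ 2 * r + c * r ^ 2)%:R in
  nnzM%:R + nnzN%:R
  + cr / eps ^+ 2
  + cr * ln (c * r)%:R / eps
  + (c ^ 3 + r ^ 3)%:R / eps
  + cr * ln c%:R * ln r%:R
  + c%:R ^+ 3 * ln c%:R
  + r%:R ^+ 3 * ln r%:R.

(* Main.v *)
Require Import Defs.
From mathcomp Require Import all_boot all_order all_algebra.
From mathcomp Require Import reals exp.
From mathcomp Require Import sequences zify ring lra.

Set Implicit Arguments.
Unset Strict Implicit.
Unset Printing Implicit Defensive.

Import Order.TTheory GRing.Theory Num.Theory.
Local Open Scope ring_scope.

(** Let [U] and [W] be orthonormal bases of the column space of [M] and of the row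
    space of [N], and split [A = U *m core *m W^T + B], where [core] holds the
    coordinates of [M *m Xstar *m N] and [B] is its residual.  On [A], sketched
    regression acts by two oblique projections, which fix [U] and [W].  Hence
    [M *m Xhat *m N - M *m Xstar *m N = U *m K *m W^T] where [K] depends on [A]
    through [B] only.  By Pythagoras ([fdot_residual]) the squared error is the
    sum of the squared norms of [B] and [K], so it suffices that the squared norm
    of [K] is at most [2 * eps] times that of [B]; this is why [1 / eps] picks are
    enough, and not [1 / eps ^ 2].

    By [sketched_coreE], [K] is a sum of three terms.  Each is the sketched product
    of two matrices whose exact product is 0, multiplied by inverses of sketched
    Gram matrices.  A sketched product of this kind is a sum of independent
    centered terms, and leverage sampling makes its mean square at most [c / sc]
    times the square of the unsketched factor ([sketched_product_mean]).

    It remains to bound the inverses, that is, to bound from below the smallest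
    eigenvalue of a sum, of mean the identity, of independent rank-one matrices.
    Matrix exponentials are avoided: the potential is the trace of a power [p], of
    order [ln c], of the resolvent of the partial sum.  Adding one rank-one matrix
    changes the resolvent by the Sherman-Morrison formula, and the moments
    [y^T *m P ^+ k *m y] of the resolvent [P] form a log-convex sequence, which
    bounds the decrease of the potential from below ([trace_update_pow]).  In the
    mean the decrease is proportional to the trace of the next power, hence the
    potential contracts geometrically down to a floor ([potential_drift]), and a
    small potential means a large smallest eigenvalue ([gram_sum_ge]).  Markov's inequality applied
    to the two potentials and to the mean square of the sketched products gives
    the probability [1 - delta] ([success_probability]).

    For the cost, the pseudoinverses of the two small sketched matrices, whose rank
    may be deficient, are computed by Greville's method, one column at a time: one
    equality test decides whether the new column depends on the previous ones, and
    the pseudoinverse then changes by a rank-one matrix, at a cost proportional to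
    its number of entries.  Computation trees are written as programs in
    continuation-passing style, for which [achieves] is a Hoare-style judgement
    with a cost bound. *)

(** * Log-convex sequences *)

Section LogConvex.
Variables (R : realFieldType) (a : nat -> R).
Hypothesis a_ge0 : forall k, 0 <= a k.
Hypothesis a_lc : forall k, a k.+1 ^+ 2 <= a k * a k.+2.

(** The ratios [a k.+1 / a k] increase; the products avoid dividing by 0. *)
Lemma logconvex_ratio i j : (i <= j)%N -> a i.+1 * a j <= a i * a j.+1.
Proof.
move=> /subnKC <-; elim: (j - i)%N => [|d IH]; first by rewrite addn0 mulrC.
rewrite addnS; set k := (i + d)%N in IH *.
have [ak0|ak_neq0] := eqVneq (a k) 0.
  have -> : a k.+1 = 0.
    apply/eqP; rewrite -sqrf_eq0; apply/eqP/le_anti.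
    by rewrite sqr_ge0 andbT (le_trans (a_lc k)) // ak0 mul0r.
  by rewrite mulr0 mulr_ge0.
have ak_gt0 : 0 < a k by rewrite lt_def ak_neq0 a_ge0.
rewrite -(ler_pM2l ak_gt0).
apply: (@le_trans _ _ (a i * a k.+1 ^+ 2)).
  have -> : a k * (a i.+1 * a k.+1) = a i.+1 * a k * a k.+1 by ring.
  by rewrite expr2 mulrA ler_wpM2r.
by rewrite [leRHS]mulrCA ler_wpM2l.
Qed.

Lemma logconvex_shift u v : a u.+1 * a v.+1 <= a 1 * a (u + v).+1.
Proof.
wlog : u v / (u <= v)%N.
  move=> H; case: (leqP u v) => [/H //|/ltnW/H]; by rewrite mulrC addnC.
elim: u v => [|u IH] v; first by rewrite add0n.
move=> uv; apply: (le_trans (logconvex_ratio _)); first exact: ltnW.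
by rewrite addSnnS; apply: IH; rewrite ltnW// ltnW.
Qed.

(** Either the last ratio is at least [t], or all the ratios are at most [t] and
    then [a k <= t ^+ k * a 0].  The sharp bound is a power of [a k]; this
    one is linear in [a k], so it passes to averages when [a] is random. *)
Lemma logconvex_linear t k : 0 < t -> t * a k - t ^+ k.+1 * a 0 <= a k.+1.
Proof.
move=> t0; have [H|H] := leP (t * a k) (a k.+1).
  by apply: le_trans H; rewrite gerBl mulr_ge0// exprn_ge0 ?ltW.
have ak_gt0 : 0 < a k by rewrite -(pmulr_rgt0 _ t0) (le_lt_trans _ H).
apply: le_trans (a_ge0 _); rewrite subr_le0 exprS -mulrA ler_pM2l//.
have step i : (i <= k)%N -> a i.+1 <= t * a i.
  move=> ik; rewrite -(ler_pM2r ak_gt0) (le_trans (logconvex_ratio ik))//.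
  by rewrite mulrAC mulrC ler_wpM2r// ltW.
have {}step i : (i <= k)%N -> a i <= t ^+ i * a 0.
  elim: i => [|i IH] ik; first by rewrite mul1r.
  apply: (le_trans (step _ (ltnW ik))).
  by rewrite exprS -mulrA ler_pM2l// IH// ltnW.
exact: step.
Qed.

(** If [t * a 0 < a 1] then every ratio exceeds [t]. *)
Lemma logconvex_root t k : 0 < t -> (0 < k)%N ->
  a k <= t ^+ k * a 0 -> a 1 <= t * a 0.
Proof.
move=> t0; case: k => // k _ H; rewrite leNgt; apply/negP => H1.
have [a00|a0_neq0] := eqVneq (a 0) 0.
  move: (a_lc 0); rewrite a00 mul0r; rewrite a00 mulr0 in H1.
  by rewrite leNgt exprn_gt0.
have a0_gt0 : 0 < a 0 by rewrite lt_def a0_neq0 a_ge0.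
have ratio j : t * a j <= a j.+1.
  rewrite -(ler_pM2l a0_gt0) (le_trans _ (logconvex_ratio (leq0n j)))//.
  by rewrite mulrA ler_wpM2r// mulrC ltW.
have grow j : t ^+ j * a 1 <= a j.+1.
  elim: j => [|j IH]; first by rewrite mul1r.
  by apply: le_trans (ratio _); rewrite exprS -mulrA ler_pM2l.
have := le_trans (grow k) H.
by rewrite exprSr -mulrA ler_pM2l ?exprn_gt0// leNgt H1.
Qed.

End LogConvex.

(** * The Frobenius inner product and positive semidefinite matrices *)

Section FrobeniusProduct.
Variable R : realFieldType.

Definition fdot m n (A B : 'M[R]_(m, n)) : R := \tr (A^T *m B).

Lemma fdotE m n (A B : 'M[R]_(m, n)) :
  fdot A B = \sum_i \sum_j A i j * B i j.
Proof.
rewrite /fdot /mxtrace exchange_big; apply: eq_bigr => i _.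
by rewrite mxE; apply: eq_bigr => j _; rewrite mxE.
Qed.

Lemma fdotC m n (A B : 'M[R]_(m, n)) : fdot A B = fdot B A.
Proof. by rewrite /fdot -mxtrace_tr trmx_mul trmxK. Qed.

Lemma fdotDr m n (A B C : 'M[R]_(m, n)) : fdot A (B + C) = fdot A B + fdot A C.
Proof. by rewrite /fdot mulmxDr mxtraceD. Qed.

Lemma fdotZr m n a (A B : 'M[R]_(m, n)) : fdot A (a *: B) = a * fdot A B.
Proof. by rewrite /fdot -scalemxAr mxtraceZ. Qed.

Lemma fdotNr m n (A B : 'M[R]_(m, n)) : fdot A (- B) = - fdot A B.
Proof. by rewrite -scaleN1r fdotZr mulN1r. Qed.

Lemma fdot0r m n (A : 'M[R]_(m, n)) : fdot A 0 = 0.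
Proof. by rewrite /fdot mulmx0 mxtrace0. Qed.

Lemma fdotDl m n (A B C : 'M[R]_(m, n)) : fdot (A + B) C = fdot A C + fdot B C.
Proof. by rewrite fdotC fdotDr !(fdotC C). Qed.

Lemma fdotZl m n a (A B : 'M[R]_(m, n)) : fdot (a *: A) B = a * fdot A B.
Proof. by rewrite fdotC fdotZr fdotC. Qed.

Lemma fdotNl m n (A B : 'M[R]_(m, n)) : fdot (- A) B = - fdot A B.
Proof. by rewrite fdotC fdotNr fdotC. Qed.

Lemma fdot_sumr m n (I : Type) (s : seq I) (P : pred I) (A : 'M[R]_(m, n)) F :
  fdot A (\sum_(i <- s | P i) F i) = \sum_(i <- s | P i) fdot A (F i).
Proof. by apply: (big_morph (fdot A)) => [B C|]; rewrite (fdotDr, fdot0r). Qed.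

Lemma fdotMl m n p (C : 'M[R]_(m, p)) A (B : 'M[R]_(m, n)) :
  fdot (C *m A) B = fdot A (C^T *m B).
Proof. by rewrite /fdot trmx_mul mulmxA. Qed.

Lemma fdotMr m n p (A : 'M[R]_(m, p)) C (B : 'M[R]_(m, n)) :
  fdot (A *m C) B = fdot A (B *m C^T).
Proof. by rewrite /fdot trmx_mul -mulmxA mxtrace_mulC mulmxA. Qed.

Lemma fdot_tr m n (A B : 'M[R]_(m, n)) : fdot A^T B^T = fdot A B.
Proof. by rewrite fdotC /fdot trmxK mxtrace_mulC. Qed.

Lemma fdot_ge0 m n (A : 'M[R]_(m, n)) : 0 <= fdot A A.
Proof.
rewrite fdotE sumr_ge0// => i _; rewrite sumr_ge0// => j _.
by rewrite -expr2 sqr_ge0.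
Qed.

Lemma fdot_eq0 m n (A : 'M[R]_(m, n)) : (fdot A A == 0) = (A == 0).
Proof.
apply/eqP/eqP => [|->]; last by rewrite fdot0r.
rewrite fdotE => /psumr_eq0P H; apply/matrixP => i j; rewrite mxE.
have /psumr_eq0P : \sum_j A i j * A i j = 0.
  by apply: H => // k _; rewrite sumr_ge0// => l _; rewrite -expr2 sqr_ge0.
move=> /(_ (fun l _ => _) j isT) K; apply/eqP; rewrite -sqrf_eq0 expr2.
by apply/eqP/K => l; rewrite -expr2 sqr_ge0.
Qed.

Lemma trmx_mul_cV n (x y : 'cV[R]_n) : x^T *m y = (fdot x y)%:M.
Proof.
rewrite [LHS]mx11_scalar /fdot; congr _%:M.
by rewrite [in RHS](mx11_scalar (x^T *m y)) mxtrace_scalar.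
Qed.

Lemma outer_mulmx m n (u : 'cV[R]_m) (y x : 'cV[R]_n) :
  u *m y^T *m x = fdot y x *: u.
Proof. by rewrite -mulmxA trmx_mul_cV mul_mx_scalar. Qed.

Lemma trace_outer n (u v : 'cV[R]_n) : \tr (u *m v^T) = fdot v u.
Proof. by rewrite mxtrace_mulC. Qed.

Lemma fdotDD m n (A B : 'M[R]_(m, n)) :
  fdot (A + B) (A + B) = fdot A A + 2 * fdot A B + fdot B B.
Proof. rewrite fdotDr !fdotDl (fdotC B A); ring. Qed.

Lemma fdotD_le m n (A B : 'M[R]_(m, n)) :
  fdot (A + B) (A + B) <= 2 * (fdot A A + fdot B B).
Proof.
have := fdot_ge0 (A - B); rewrite !fdotDD fdotNr fdotNl fdotNr; lra.
Qed.

(** Testing on matrices [X] amounts to testing on their columns; taking [X] to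
    be the identity gives access to traces. *)
Definition psd n (P : 'M[R]_n) : Prop :=
  P^T = P /\ forall q (X : 'M_(n, q)), 0 <= fdot X (P *m X).

Lemma psd1 n : psd (1%:M : 'M[R]_n).
Proof. by split=> [|q X]; rewrite ?trmx1// mul1mx fdot_ge0. Qed.

Lemma psdMM n k (P : 'M[R]_n) (B : 'M[R]_(n, k)) :
  psd P -> psd (B^T *m P *m B).
Proof.
move=> [PT P0]; split=> [|q X]; first by rewrite !trmx_mul trmxK PT mulmxA.
by rewrite -!mulmxA -fdotMl.
Qed.

Lemma psdD n (P Q : 'M[R]_n) : psd P -> psd Q -> psd (P + Q).
Proof.
move=> [PT P0] [QT Q0]; split=> [|q X]; first by rewrite raddfD /= PT QT.
by rewrite mulmxDl fdotDr addr_ge0.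
Qed.

Lemma psdZ n a (P : 'M[R]_n) : 0 <= a -> psd P -> psd (a *: P).
Proof.
move=> a0 [PT P0]; split=> [|q X]; first by rewrite linearZ /= PT.
by rewrite -scalemxAl fdotZr mulr_ge0.
Qed.

Lemma psd_sum n (I : Type) (s : seq I) (F : I -> 'M[R]_n) :
  (forall i, psd (F i)) -> psd (\sum_(i <- s) F i).
Proof.
move=> HF; elim/big_ind: _ => //; last exact: psdD.
by split=> [|q X]; rewrite ?trmx0// mul0mx fdot0r.
Qed.

Lemma psd_outer n (y : 'cV[R]_n) : psd (y *m y^T).
Proof.
split=> [|q X]; first by rewrite trmx_mul trmxK.
by rewrite -mulmxA -{1}[y]trmxK -fdotMl fdot_ge0.
Qed.

Lemma psd_CauchySchwarz n q (P : 'M[R]_n) (X Y : 'M_(n, q)) : psd P ->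
  fdot X (P *m Y) ^+ 2 <= fdot X (P *m X) * fdot Y (P *m Y).
Proof.
move=> [PT P0]; set b := fdot X (P *m Y).
set a := fdot X (P *m X); set d := fdot Y (P *m Y).
have H t : 0 <= a + 2 * t * b + t ^+ 2 * d.
  have := P0 _ (X + t *: Y); rewrite mulmxDr -scalemxAr.
  rewrite !(fdotDl, fdotDr, fdotZl, fdotZr) -/a -/b -/d.
  have -> : fdot Y (P *m X) = b by rewrite fdotC fdotMl PT.
  move=> /le_trans; apply; rewrite le_eqVlt; apply/orP; left; apply/eqP; ring.
have d0 : 0 <= d by exact: P0.
have [de|dn] := eqVneq d 0.
  (* The polynomial in [t] is affine and nonnegative, hence constant. *)
  have [->|bn] := eqVneq b 0; first by rewrite expr0n de mulr0.
  have := H (- (a + 1) / (2 * b)); rewrite de mulr0 addr0.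
  have -> : a + 2 * (- (a + 1) / (2 * b)) * b = -1 by field.
  by rewrite ler0N1.
have dp : 0 < d by rewrite lt_def dn.
have := H (- b / d).
have -> : a + 2 * (- b / d) * b + (- b / d) ^+ 2 * d = (a * d - b ^+ 2) / d.
  by field.
by rewrite pmulr_lge0 ?invr_gt0// subr_ge0.
Qed.

Lemma fdot_CauchySchwarz m n (A B : 'M[R]_(m, n)) :
  fdot A B ^+ 2 <= fdot A A * fdot B B.
Proof. by have := psd_CauchySchwarz A B (psd1 m); rewrite !mul1mx. Qed.

Lemma fdotM_le m n p (A : 'M[R]_(m, n)) (B : 'M[R]_(n, p)) :
  fdot (A *m B) (A *m B) <= fdot A A * fdot B B.
Proof.
have -> : fdot A A * fdot B B =
    \sum_i \sum_j fdot (row i A)^T (row i A)^T * fdot (col j B) (col j B).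
  rewrite fdotE -(fdot_tr B B) (fdotE B^T) mulr_suml; apply: eq_bigr => i _.
  rewrite mulr_sumr; apply: eq_bigr => j _; rewrite fdot_tr !fdotE big_ord1.
  congr (_ * _); apply: eq_bigr => k _; first by rewrite !mxE.
  by rewrite big_ord1 !mxE.
rewrite fdotE; apply: ler_sum => i _; apply: ler_sum => j _.
apply: le_trans (fdot_CauchySchwarz _ _); rewrite expr2.
suff -> : (A *m B) i j = fdot (row i A)^T (col j B) by [].
rewrite fdotE mxE; apply: eq_bigr => k _; rewrite big_ord1.
by rewrite /row /col !mxE.
Qed.

Lemma trmxX n (P : 'M[R]_n) k : (P ^+ k)^T = P^T ^+ k.
Proof.
by elim: k => [|k IH]; [rewrite trmx1|rewrite exprSr trmx_mul IH exprS].
Qed.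

Lemma psdX n (P : 'M[R]_n) k : psd P -> psd (P ^+ k).
Proof.
move=> hP; have [PT _] := hP.
have -> : k = (k./2 + odd k + k./2)%N.
  by rewrite addnAC addnn addnC odd_double_half.
rewrite 2!exprD -{1}PT -trmxX; apply: psdMM.
by case: (odd k); [rewrite expr1|rewrite expr0; exact: psd1].
Qed.

Section Coercive.
Variables (n : nat) (G : 'M[R]_n) (eta : R).
Hypothesis eta_gt0 : 0 < eta.
Hypothesis G_ge : forall q (X : 'M_(n, q)), eta * fdot X X <= fdot X (G *m X).

Lemma coercive_unit : G \in unitmx.
Proof.
rewrite -row_free_unit -kermx_eq0 -trmx_eq0 -fdot_eq0.
have := G_ge (kermx G)^T.
rewrite -[G in G *m _]trmxK -fdotMl -trmx_mul mulmx_ker trmx0 fdotC fdot0r.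
rewrite pmulr_rle0// => K_le0.
by apply/eqP/le_anti; rewrite K_le0 fdot_ge0.
Qed.

(** By Cauchy-Schwarz a coercive matrix multiplies norms by at least [eta]. *)
Lemma fdot_coercive_inv q (X : 'M_(n, q)) :
  eta ^+ 2 * fdot (invmx G *m X) (invmx G *m X) <= fdot X X.
Proof.
set Y := invmx G *m X; have GY : G *m Y = X.
  by rewrite /Y mulmxA mulmxV ?coercive_unit// mul1mx.
have := G_ge Y; have := fdot_CauchySchwarz Y X; rewrite GY.
have := fdot_ge0 X; have := fdot_ge0 Y.
move: (fdot Y Y) (fdot Y X) (fdot X X) => a b d; rewrite le_eqVlt.
case/predU1P=> [<-|a_gt0] d_ge0 CS ab; first by rewrite mulr0.
rewrite -(ler_pM2l a_gt0); apply: le_trans CS.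
have -> : a * (eta ^+ 2 * a) = (eta * a) ^+ 2 by ring.
by rewrite lerXn2r ?nnegrE ?(le_trans _ ab)// mulr_ge0// ltW.
Qed.

End Coercive.

Section Moments.
Variables (n q : nat) (P : 'M[R]_n) (X : 'M[R]_(n, q)).
Hypothesis psdP : psd P.

Definition moment k := fdot X (P ^+ k *m X).

Lemma moment_ge0 k : 0 <= moment k.
Proof. by have [_] := psdX k psdP; apply. Qed.

(** Cauchy-Schwarz for the form [P ^+ k] between [X] and [P *m X]. *)
Lemma moment_logconvex k : moment k.+1 ^+ 2 <= moment k * moment k.+2.
Proof.
have [PT _] := psdP.
have := psd_CauchySchwarz X (P *m X) (psdX k psdP).
rewrite fdotMl PT !mulmxA -[P ^+ k *m P]exprSr -[P *m P ^+ k]exprS.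
by rewrite -[_ *m P]exprSr.
Qed.

Lemma moment0 : moment 0 = fdot X X.
Proof. by rewrite /moment mul1mx. Qed.

End Moments.
End FrobeniusProduct.

(** * Powers of a resolvent under a rank-one update *)

Section RankOneUpdate.
Variables (R : realFieldType) (n : nat) (P : 'M[R]_n) (y : 'cV[R]_n).
Hypothesis psdP : psd P.

Local Notation a := (moment P y).

(** The inverse of [invmx P + y *m y^T], by the Sherman-Morrison formula. *)
Definition update := P - (1 + a 1)^-1 *: (P *m y *m (P *m y)^T).

Lemma Sherman_Morrison M :
  M *m P = 1%:M -> (M + y *m y^T) *m update = 1%:M.
Proof.
move=> MP; have [PT _] := psdP.
have a_gt0 : 0 < 1 + a 1 by rewrite ltr_pwDl ?moment_ge0.
rewrite /update mulmxBr -scalemxAr !mulmxDl MP.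
have -> : M *m (P *m y *m (P *m y)^T) = y *m (P *m y)^T.
  by rewrite !mulmxA MP mul1mx.
have -> : y *m y^T *m P = y *m (P *m y)^T by rewrite trmx_mul PT mulmxA.
rewrite [y *m y^T *m _]mulmxA outer_mulmx -scalemxAl -/(a 1).
rewrite -{2}[y *m (P *m y)^T]scale1r -scalerDl scalerA mulVf ?lt0r_neq0//.
by rewrite scale1r addrK.
Qed.

Lemma update_sym : update^T = update.
Proof.
have [PT _] := psdP.
by rewrite /update linearB linearZ /= (trmx_mul (P *m y)) trmxK PT.
Qed.

Lemma fdot_update q (x : 'M_(n, q)) : fdot x (update *m x) <= fdot x (P *m x).
Proof.
rewrite /update mulmxBl fdotDr fdotNr gerBl -scalemxAl fdotZr mulr_ge0//.
  by rewrite invr_ge0 addr_ge0 ?ler01 ?moment_ge0.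
by have [_] := psd_outer (P *m y); apply.
Qed.

Local Notation F j l := (fdot (P *m y) (update ^+ j *m (P ^+ l *m y))).

Lemma update_mul_Krylov l :
  update *m (P ^+ l *m y) =
    P ^+ l.+1 *m y - (a l.+1 / (1 + a 1)) *: (P ^+ 1 *m y).
Proof.
have [PT _] := psdP.
rewrite /update mulmxBl mulmxA -[P *m P ^+ l]exprS -scalemxAl outer_mulmx.
rewrite scalerA expr1 [in RHS]mulrC; congr (_ - (_ * _) *: _).
by rewrite fdotMl PT mulmxA -[P *m P ^+ l]exprS.
Qed.

(** Replacing [P] by [update] in [moment P y (j + l).+1] costs at most a factor
    [1 - j * a 1]: by [update_mul_Krylov] each replacement subtracts a
    nonnegative term, which log-convexity bounds by
    [a l.+1 * a j.+2 <= a 1 * a (j + l).+2]. *)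
Lemma Krylov_bounds j l : j%:R * a 1 <= 1 ->
  (1 - j%:R * a 1) * a (j + l).+1 <= F j l <= a (j + l).+1.
Proof.
have [PT _] := psdP; have a_ge0 := moment_ge0 y psdP.
elim: j l => [|j IH] l ja1.
  have -> : F 0 l = a l.+1.
    by rewrite expr0 mul1mx fdotMl PT mulmxA -[P *m P ^+ l]exprS.
  by rewrite mul0r subr0 mul1r add0n lexx.
have {}ja1 : (j%:R + 1) * a 1 <= 1 by move: ja1; rewrite -natr1.
have ja1' : j%:R * a 1 <= 1.
  by apply: le_trans ja1; rewrite ler_wpM2r// lerDl.
have /andP[lo1 up1] := IH 1 ja1'; have /andP[lo up] := IH l.+1 ja1'.
have -> : F j.+1 l = F j l.+1 - a l.+1 / (1 + a 1) * F j 1.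
  by rewrite exprSr -mulmxA update_mul_Krylov mulmxBr fdotDr fdotNr
             -scalemxAr fdotZr.
have F1_ge0 : 0 <= F j 1 by apply: le_trans lo1; rewrite mulr_ge0// subr_ge0.
have c_ge0 : 0 <= (1 + a 1)^-1 by rewrite invr_ge0 addr_ge0.
have c_le1 : (1 + a 1)^-1 <= 1 by rewrite invf_le1 ?ltr_pwDl// lerDl.
rewrite addSn addnS in up lo *; rewrite addn1 in up1.
have drop_ge0 : 0 <= a l.+1 / (1 + a 1) * F j 1 by rewrite !mulr_ge0.
apply/andP; split; last by apply: le_trans up; rewrite gerBl.
have drop_le : a l.+1 / (1 + a 1) * F j 1 <= a 1 * a (j + l).+2.
  have shift := logconvex_shift a_ge0 (moment_logconvex y psdP) l j.+1.
  rewrite addnS (addnC l j) in shift; apply: le_trans shift.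
  rewrite -mulrA ler_wpM2l//; apply: le_trans up1.
  by rewrite -[leRHS]mul1r ler_wpM2r.
rewrite -natr1; move: lo drop_le.
move: (F j l.+1) (a l.+1 / _ * _) => f d; lra.
Qed.

(** The trace telescopes over the words [update ^+ j *m P ^+ i], each exchange
    of one factor costing [F j i.+1 / (1 + a 1)].  The smallness of [a 1]
    keeps the factor [1 - j * a 1] of [Krylov_bounds] above [1 / 2] for all
    [j <= p]. *)
Lemma trace_update_pow p : (0 < p)%N -> 2 * p%:R * a 1 <= 1 ->
  \tr (update ^+ p) <= \tr (P ^+ p) - p%:R / 3 * a p.+1.
Proof.
move=> p_gt0 small; have [PT _] := psdP; have a_ge0 := moment_ge0 y psdP.
have a1_le : 2 * a 1 <= 1.
  apply: le_trans small; rewrite ler_wpM2r// ler_peMr//.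
  by rewrite (ler_nat R 1).
have word j i : (j + i = p)%N ->
    \tr (update ^+ j *m P ^+ i) <= \tr (P ^+ p) - j%:R / 3 * a p.+1.
  elim: j i => [|j IH] i; first by move=> <-; rewrite mul1mx !mul0r subr0.
  rewrite addSnnS => Ep.
  apply: (@le_trans _ _ (\tr (update ^+ j *m P ^+ i.+1) - a p.+1 / 3));
    last first.
    by have := IH _ Ep; rewrite -natr1; lra.
  have -> : \tr (update ^+ j.+1 *m P ^+ i) =
      \tr (update ^+ j *m P ^+ i.+1) - (1 + a 1)^-1 * F j i.+1.
    rewrite exprSr -mulmxA {2}/update mulmxBl -[P *m P ^+ i]exprS mulmxBr.
    rewrite raddfB /=.
    congr (_ - _); rewrite -scalemxAl -scalemxAr mxtraceZ; congr (_ * _).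
    have -> : update ^+ j *m (P *m y *m (P *m y)^T *m P ^+ i) =
        update ^+ j *m (P *m y) *m (P ^+ i *m (P *m y))^T.
      by rewrite [in RHS]trmx_mul trmxX PT !mulmxA.
    rewrite trace_outer fdotC fdotMl trmxX update_sym.
    by rewrite [P ^+ i *m _]mulmxA -[P ^+ i *m P]exprSr.
  have jp : (j <= p)%N by rewrite -Ep leq_addr.
  have ja1 : j%:R * a 1 <= 1 / 2.
    have : j%:R * a 1 <= p%:R * a 1 by rewrite ler_wpM2r// ler_nat.
    move: small; lra.
  have /andP[lo _] : (1 - j%:R * a 1) * a p.+1 <= F j i.+1 <= a p.+1.
    by rewrite -Ep; apply: Krylov_bounds; move: ja1; lra.
  have half : a p.+1 / 2 <= F j i.+1.
    apply: le_trans lo; rewrite mulrC ler_wpM2r//; move: ja1; lra.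
  have inv_ge : 2 / 3 <= (1 + a 1)^-1.
    rewrite -[2 / 3]invrK lef_pV2 ?posrE ?ltr_pwDl// invf_div.
    by move: a1_le; lra.
    by lra.
  rewrite lerD2l lerN2; apply: (@le_trans _ _ (2 / 3 * (a p.+1 / 2))).
    lra.
  by rewrite ler_pM// divr_ge0.
by have := word p 0 (addn0 p); rewrite mulmx1.
Qed.

End RankOneUpdate.

(** * Independent picks *)

Section IidExpectation.
Variables (R : realFieldType) (T : finType) (prob : T -> R).
Hypothesis prob_ge0 : forall i, 0 <= prob i.
Hypothesis prob_sum1 : \sum_i prob i = 1.

(** Expectation over [s] independent picks, presented as a list so that the
    first pick can be split off. *)
Fixpoint iidE s (f : seq T -> R) : R :=
  if s is s'.+1 then \sum_i prob i * iidE s' (fun ws => f (i :: ws))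
  else f [::].

Lemma iidE_ffun s f :
  \sum_(w : {ffun 'I_s -> T}) (\prod_j prob (w j)) * f (codom w) = iidE s f.
Proof.
elim: s f => [|s IH] f /=.
  pose w0 : {ffun 'I_0 -> T} := ffun0 (card_ord 0).
  rewrite (big_pred1 w0) => [|w]; last first.
    by have -> : w = w0 by [apply/ffunP; case]; rewrite /= eqxx.
  by rewrite big_ord0 mul1r codomE enum_ord0.
pose cons_ffun (iw : T * {ffun 'I_s -> T}) : {ffun 'I_s.+1 -> T} :=
  [ffun j => if unlift ord0 j is Some k then iw.2 k else iw.1].
pose uncons_ffun (w : {ffun 'I_s.+1 -> T}) :=
  (w ord0, [ffun k => w (lift ord0 k)]).
rewrite (reindex cons_ffun) /=; last first.
  exists uncons_ffun => [[i w] _|w _].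
    congr pair; first by rewrite ffunE unlift_none.
    by apply/ffunP => k; rewrite !ffunE liftK.
  apply/ffunP => j; rewrite ffunE /=.
  by case: unliftP => [k|] ->; rewrite ?ffunE.
rewrite -(pair_bigA _ (fun i w =>
  (\prod_j prob (cons_ffun (i, w) j)) * f (codom (cons_ffun (i, w))))) /=.
apply: eq_bigr => i _; rewrite -IH mulr_sumr; apply: eq_bigr => w _.
rewrite big_ord_recl ffunE unlift_none -mulrA; congr (_ * (_ * f _)).
  by apply: eq_bigr => k _; rewrite ffunE liftK.
rewrite !codomE enum_ordSl /= ffunE unlift_none -map_comp; congr (_ :: _).
by apply: eq_map => k; rewrite /= ffunE liftK.
Qed.

Lemma iidE_ext s f g : f =1 g -> iidE s f = iidE s g.
Proof.
elim: s f g => [|s IH] f g fg /=; first exact: fg.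
by apply: eq_bigr => i _; congr (_ * _); apply: IH => ws; apply: fg.
Qed.

Lemma iidE_le s f g : (forall ws, f ws <= g ws) -> iidE s f <= iidE s g.
Proof.
elim: s f g => [|s IH] f g fg /=; first exact: fg.
by apply: ler_sum => i _; rewrite ler_wpM2l// IH.
Qed.

Lemma iidE_cst s k : iidE s (fun=> k) = k.
Proof. by elim: s => //= s ->; rewrite -mulr_suml prob_sum1 mul1r. Qed.

Lemma iidED s f g : iidE s (fun ws => f ws + g ws) = iidE s f + iidE s g.
Proof.
elim: s f g => [//|s IH] f g /=; rewrite -big_split /=.
by apply: eq_bigr => i _; rewrite IH mulrDr.
Qed.

Lemma iidEZ s k f : iidE s (fun ws => k * f ws) = k * iidE s f.
Proof.
elim: s f => [//|s IH] f /=; rewrite mulr_sumr.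
by apply: eq_bigr => i _; rewrite IH mulrCA.
Qed.

Lemma iidE_affine s k f b : iidE s (fun ws => k * f ws + b) = k * iidE s f + b.
Proof. by rewrite (iidED s (fun ws => k * f ws)) iidEZ iidE_cst. Qed.

Lemma iidE_sum (I : Type) (r : seq I) s F :
  iidE s (fun ws => \sum_(i <- r) F i ws) = \sum_(i <- r) iidE s (F i).
Proof.
elim: r => [|i r IH].
  by rewrite big_nil -[RHS](iidE_cst s); apply: iidE_ext => ws; rewrite big_nil.
by rewrite big_cons -IH -iidED; apply: iidE_ext => ws; rewrite big_cons.
Qed.

Lemma iidES s f :
  iidE s.+1 f = iidE s (fun ws => \sum_i prob i * f (i :: ws)).
Proof. by rewrite iidE_sum; apply: eq_bigr => i _; rewrite iidEZ. Qed.

End IidExpectation.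

(** * Smallest eigenvalue of a sum of independent rank-one matrices *)

Section LowerTail.
Variables (R : realFieldType) (T : finType) (prob : T -> R).
Hypothesis prob_ge0 : forall i, 0 <= prob i.
Hypothesis prob_sum1 : \sum_i prob i = 1.
Variables (n : nat) (y : T -> 'cV[R]_n) (sigma eta : R).
Hypothesis eta_gt0 : 0 < eta.
Hypothesis isotropic : \sum_i prob i *: (y i *m (y i)^T) = sigma%:M.

Definition gram_sum (ws : seq T) : 'M[R]_n := \sum_(i <- ws) y i *m (y i)^T.

(** The multiple of the identity makes the matrix invertible before any pick;
    it is subtracted again in [gram_sum_ge]. *)
Definition regularized ws := eta%:M + gram_sum ws.

Definition resolvent ws := invmx (regularized ws).

Lemma psd_gram_sum ws : psd (gram_sum ws).
Proof. by apply: psd_sum => i; apply: psd_outer. Qed.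

Lemma psd_regularized ws : psd (regularized ws).
Proof.
by rewrite /regularized -scalemx1; apply: psdD (psd_gram_sum ws);
  apply: psdZ (psd1 _ _); apply: ltW.
Qed.

Lemma regularized_ge ws q (x : 'M_(n, q)) :
  eta * fdot x x <= fdot x (regularized ws *m x).
Proof.
rewrite /regularized mulmxDl mul_scalar_mx fdotDr fdotZr lerDl.
by have [_] := psd_gram_sum ws; apply.
Qed.

Lemma regularized_unit ws : regularized ws \in unitmx.
Proof.
exact: coercive_unit eta_gt0 (regularized_ge ws).
Qed.

Lemma psd_resolvent ws : psd (resolvent ws).
Proof.
have [rT _] := psd_regularized ws.
have := psdMM (resolvent ws) (psd_regularized ws).
have -> : (resolvent ws)^T = resolvent ws by rewrite trmx_inv rT.
by rewrite mulVmx ?regularized_unit// mul1mx.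
Qed.

Lemma resolvent_cons i ws : resolvent (i :: ws) = update (resolvent ws) (y i).
Proof.
have MN := mulmxV (regularized_unit ws).
have := Sherman_Morrison (y i) (psd_resolvent ws) MN.
have -> : regularized ws + y i *m (y i)^T = regularized (i :: ws).
  by rewrite /regularized /gram_sum big_cons addrCA addrC.
move=> E; rewrite -[RHS]mul1mx -(mulVmx (regularized_unit (i :: ws))).
by rewrite -mulmxA E mulmx1.
Qed.

Lemma resolvent_le ws q (x : 'M_(n, q)) :
  fdot x (resolvent ws *m x) <= eta^-1 * fdot x x.
Proof.
elim: ws => [|i ws IH].
  rewrite /resolvent /regularized /gram_sum big_nil addr0 invmx_scalar.
  by rewrite mul_scalar_mx fdotZr.
rewrite resolvent_cons; apply: le_trans IH.
by apply: fdot_update; apply: psd_resolvent.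
Qed.

Section Drift.
Variables (rho tau : R) (p : nat).
Hypothesis y_bounded : forall i, fdot (y i) (y i) <= rho.
Hypothesis rho_small : 2 * p%:R * rho <= eta.
Hypothesis p_gt0 : (0 < p)%N.
Hypothesis tau_gt0 : 0 < tau.
Hypothesis sigma_ge0 : 0 <= sigma.

Local Notation Phi ws := (\tr (resolvent ws ^+ p)).
Local Notation beta := (p%:R / 3 * sigma * tau).

(** One more pick decreases the potential [Phi] in the mean, down to a floor of
    order [n * tau ^+ p]: by isotropy [trace_update_pow] averages to a decrease
    proportional to [\tr (resolvent ws ^+ p.+1)], which [logconvex_linear]
    compares with [Phi] itself. *)
Lemma potential_drift ws :
  \sum_i prob i * Phi (i :: ws) <=
    (1 - beta) * Phi ws + beta * (n%:R * tau ^+ p).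
Proof.
set N := resolvent ws; have pN : psd N by exact: psd_resolvent.
have step i : \tr (resolvent (i :: ws) ^+ p) <=
    \tr (N ^+ p) - p%:R / 3 * moment N (y i) p.+1.
  rewrite resolvent_cons; apply: trace_update_pow => //.
  have : moment N (y i) 1 <= eta^-1 * rho.
    apply: le_trans (resolvent_le ws (y i)) _.
    by rewrite ler_wpM2l// invr_ge0 ltW.
  move=> /(ler_wpM2l (_ : 0 <= 2 * p%:R)) H; apply: le_trans (H _) _.
    by rewrite mulr_ge0.
  by rewrite mulrCA mulrC ler_pdivrMr// mul1r.
apply: (@le_trans _ _ (\sum_i prob i *
    (\tr (N ^+ p) - p%:R / 3 * moment N (y i) p.+1))).
  by apply: ler_sum => i _; rewrite ler_wpM2l// step.
have -> : \sum_i prob i * (\tr (N ^+ p) - p%:R / 3 * moment N (y i) p.+1) =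
    \tr (N ^+ p) - p%:R / 3 * sigma * moment N 1%:M p.+1.
  transitivity (\sum_i (prob i * \tr (N ^+ p) -
      p%:R / 3 * (prob i * moment N (y i) p.+1))).
    by apply: eq_bigr => i _; ring.
  rewrite sumrB -mulr_suml prob_sum1 mul1r -mulr_sumr -mulrA.
  congr (_ - _ * _).
  have -> : sigma * moment N 1%:M p.+1 = \tr (N ^+ p.+1 *m sigma%:M).
    by rewrite mul_mx_scalar mxtraceZ /moment /fdot trmx1 mul1mx mulmx1.
  rewrite -isotropic mulmx_sumr raddf_sum /=; apply: eq_bigr => i _.
  by rewrite -scalemxAr mxtraceZ mulmxA trace_outer.
have floor := logconvex_linear (moment_ge0 1%:M pN) (moment_logconvex 1%:M pN)
  p tau_gt0.
have m0 : moment N 1%:M 0 = n%:R by rewrite moment0 /fdot trmx1 mulmx1 mxtrace1.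
have mp : moment N 1%:M p = \tr (N ^+ p).
  by rewrite /moment /fdot trmx1 mul1mx mulmx1.
rewrite m0 mp in floor.
have := ler_wpM2l (_ : 0 <= p%:R / 3 * sigma) floor.
rewrite mulr_ge0 ?divr_ge0// => /(_ isT).
rewrite exprS; move: (\tr _) (moment _ _ _) => X Y; lra.
Qed.

Lemma potential_mean s : beta <= 1 ->
  iidE prob s (fun ws => Phi ws) <=
    (1 - beta) ^+ s * (n%:R * eta^-1 ^+ p) + n%:R * tau ^+ p.
Proof.
move=> beta_le1; elim: s => [|s IH].
  rewrite /= expr0 mul1r /resolvent /regularized /gram_sum big_nil addr0.
  rewrite invmx_scalar.
  have -> : (eta^-1)%:M ^+ p = (eta^-1 ^+ p)%:M :> 'M[R]_n.
    by elim: (p) => [|k IH]; rewrite ?expr0// !exprS IH scalar_mxM.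
  by rewrite mxtrace_scalar !mulr_natl lerDl mulrn_wge0// exprn_ge0// ltW.
rewrite (iidES prob_sum1).
apply: le_trans (iidE_le prob_ge0 s potential_drift) _.
rewrite iidE_affine//.
apply: le_trans (lerD (ler_wpM2l _ IH) (lexx _)) _; first by rewrite subr_ge0.
rewrite exprS; lra.
Qed.

End Drift.

(** The trace of an even power of the resolvent is a sum of squares, so it
    bounds the top moments of every vector, and [logconvex_root] the first ones:
    the resolvent is at most [(2 * eta)^-1], its inverse at least [2 * eta]. *)
Lemma gram_sum_ge q ws : (0 < q)%N ->
  \tr (resolvent ws ^+ q.*2) <= (2 * eta)^-1 ^+ q.*2 ->
  forall d (x : 'M_(n, d)), eta * fdot x x <= fdot x (gram_sum ws *m x).
Proof.
move=> q_gt0 small d x; set N := resolvent ws in small.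
have pN : psd N by exact: psd_resolvent.
have [NT _] := pN.
have a_p : moment N x q.*2 <= (2 * eta)^-1 ^+ q.*2 * moment N x 0.
  rewrite moment0.
  apply: (@le_trans _ _ (\tr (N ^+ q.*2) * fdot x x)); last first.
    by rewrite ler_wpM2r ?fdot_ge0.
  have NqT : (N ^+ q)^T = N ^+ q by rewrite trmxX NT.
  have -> : \tr (N ^+ q.*2) = fdot (N ^+ q) (N ^+ q).
    by rewrite /fdot NqT -addnn exprD.
  have -> : moment N x q.*2 = fdot (N ^+ q *m x) (N ^+ q *m x).
    by rewrite fdotMl NqT mulmxA -addnn /moment exprD.
  exact: fdotM_le.
have eta2 : 0 < (2 * eta)^-1 by rewrite invr_gt0 mulr_gt0.
have := logconvex_root (moment_ge0 x pN) (moment_logconvex x pN) eta2 _ a_p.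
rewrite double_gt0 moment0 => /(_ q_gt0) a1.
have := psd_CauchySchwarz x (regularized ws *m x) pN.
have -> : N *m (regularized ws *m x) = x.
  by rewrite mulmxA mulVmx ?regularized_unit// mul1mx.
have := regularized_ge ws x; rewrite [fdot (_ *m x) x]fdotC.
have -> : fdot x (regularized ws *m x) =
    eta * fdot x x + fdot x (gram_sum ws *m x).
  by rewrite /regularized mulmxDl mul_scalar_mx fdotDr fdotZr.
move: a1; rewrite /moment expr1 mulrC ler_pdivlMr ?mulr_gt0//.
have := fdot_ge0 x; rewrite le_eqVlt => /predU1P[<-|].
  by rewrite mulr0 add0r.
move: (fdot x x) (fdot x (N *m x)) (fdot x (gram_sum ws *m x)) => X U G.
move=> X0 U_le G_ge CS; rewrite -(ler_pM2l X0).
have M_ge0 : 0 <= eta * X + G.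
  by apply: le_trans G_ge; rewrite mulr_ge0 ?ltW.
have := ler_wpM2r M_ge0 U_le.
have := ler_wpM2l (ltW eta_gt0) CS.
rewrite expr2; lra.
Qed.

End LowerTail.

(** * Second moment of a sketched product *)

Section SecondMoment.
Variables (R : realFieldType) (T : finType) (prob : T -> R).
Hypothesis prob_sum1 : \sum_i prob i = 1.

(** Independence: the cross terms of the square average to 0. *)
Lemma iidE_sum_centered m n (Y : T -> 'M[R]_(m, n)) s :
    \sum_i prob i *: Y i = 0 ->
  iidE prob s (fun ws => fdot (\sum_(i <- ws) Y i) (\sum_(i <- ws) Y i)) =
    s%:R * \sum_i prob i * fdot (Y i) (Y i).
Proof.
move=> Y0; elim: s => [|s IH]; first by rewrite /= big_nil fdot0r mul0r.
rewrite (iidES prob_sum1) -natr1 mulrDl mul1r -IH.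
set v := \sum_i _ * fdot _ _; rewrite -[X in X + v]mul1r.
rewrite -(iidE_affine prob_sum1).
apply: iidE_ext => ws; rewrite mul1r; set S := \sum_(i <- ws) Y i.
transitivity (\sum_i (prob i * fdot S S + 2 * fdot S (prob i *: Y i) +
    prob i * fdot (Y i) (Y i))).
  by apply: eq_bigr => i _; rewrite big_cons addrC fdotDD fdotZr; ring.
rewrite !big_split /= -mulr_suml prob_sum1 mul1r -mulr_sumr -fdot_sumr Y0.
by rewrite fdot0r mulr0 addr0.
Qed.

End SecondMoment.

(** * Leverage-score sketches *)

Section Leverage.
Variables (R : realType) (p k s : nat) (V : 'M[R]_(p, k)).
Hypothesis V_orth : V^T *m V = 1%:M.
Hypothesis k_gt0 : (0 < k)%N.
Hypothesis s_gt0 : (0 < s)%N.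

Local Notation l := (leverage V).

Lemma leverage_ge0 i : 0 <= l i.
Proof. by rewrite divr_ge0// sumr_ge0// => j _; rewrite sqr_ge0. Qed.

Lemma pick_weight_ge0 i : 0 <= l i * s%:R.
Proof. by rewrite mulr_ge0// leverage_ge0. Qed.

Lemma fdot_row i : fdot (row i V)^T (row i V)^T = l i * k%:R.
Proof.
rewrite /leverage divfK ?pnatr_eq0 -?lt0n// fdot_tr fdotE big_ord1.
by apply: eq_bigr => j _; rewrite !mxE expr2.
Qed.

Lemma row_eq0 i : l i = 0 -> row i V = 0.
Proof.
by move=> li; apply/eqP; rewrite -trmx_eq0 -fdot_eq0 fdot_row li mul0r.
Qed.

Lemma leverage_sum1 : \sum_i l i = 1.
Proof.
rewrite -mulr_suml; have -> : \sum_i \sum_j V i j ^+ 2 = k%:R.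
  transitivity (fdot V V); last by rewrite /fdot V_orth mxtrace1.
  by rewrite fdotE; do 2!apply: eq_bigr => ? _; rewrite expr2.
by rewrite divff// pnatr_eq0 -lt0n.
Qed.

Lemma sketchE (w : picks p s) h i :
  sketch V w h i = (w h == i)%:R / Num.sqrt (l (w h) * s%:R).
Proof. by rewrite /sketch mxE mul_mx_diag !mxE mul1r. Qed.

Lemma mul_sketch n (w : picks p s) (Y : 'M[R]_(p, n)) h b :
  (sketch V w *m Y) h b = sketch V w h (w h) * Y (w h) b.
Proof.
rewrite mxE (bigD1 (w h))//= big1 ?addr0// => i iw.
by rewrite sketchE eq_sym (negPf iw) !mul0r.
Qed.

(** [(sketch V w)^T *m sketch V w] is diagonal, which makes every product
    through it a sum over the picks. *)
Lemma sketch_mul m n (X : 'M[R]_(m, p)) (Y : 'M[R]_(p, n)) (w : picks p s) :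
  X *m (sketch V w)^T *m (sketch V w *m Y) =
    \sum_(i <- codom w) (l i * s%:R)^-1 *: (col i X *m row i Y).
Proof.
rewrite codomE big_map big_enum /=; apply/matrixP => a b.
rewrite mxE summxE; apply: eq_bigr => h _; rewrite mul_sketch.
have -> : (X *m (sketch V w)^T) a h = X a (w h) * sketch V w h (w h).
  by rewrite -[X]trmxK -trmx_mul mxE mul_sketch mulrC [X^T^T _ _]mxE.
rewrite [RHS]mxE [in RHS]mxE big_ord1 [col _ _ _ _]mxE [row _ _ _ _]mxE.
rewrite !sketchE eqxx !mul1r [_^-1 * Y _ _]mulrC mulrACA -invfM -expr2.
by rewrite sqr_sqrtr ?pick_weight_ge0// mulrC.
Qed.

(** The row of [sketch V w *m V] that a pick of [i] produces. *)
Definition scaled_row i : 'cV[R]_k := (Num.sqrt (l i * s%:R))^-1 *: (row i V)^T.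

Lemma scaled_row_outer i : scaled_row i *m (scaled_row i)^T =
  (l i * s%:R)^-1 *: ((row i V)^T *m row i V).
Proof.
rewrite /scaled_row linearZ /= trmxK -scalemxAl -scalemxAr scalerA.
by rewrite -invfM -expr2 sqr_sqrtr ?pick_weight_ge0.
Qed.

Lemma sketch_gram (w : picks p s) :
  (sketch V w *m V)^T *m (sketch V w *m V) = gram_sum scaled_row (codom w).
Proof.
rewrite trmx_mul sketch_mul; apply: eq_bigr => i _.
by rewrite scaled_row_outer tr_row.
Qed.

Lemma scaled_row_isotropic :
  \sum_i l i *: (scaled_row i *m (scaled_row i)^T) = (s%:R^-1)%:M.
Proof.
have VV : V^T *m V = \sum_i (row i V)^T *m row i V.
  apply/matrixP => a b; rewrite mxE summxE; apply: eq_bigr => i _.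
  by rewrite [RHS]mxE big_ord1 !mxE.
rewrite -scalemx1 -V_orth VV scaler_sumr; apply: eq_bigr => i _.
rewrite scaled_row_outer scalerA.
(* A row of leverage 0 vanishes, whatever the weight [0^-1] is. *)
have [/row_eq0->|li] := eqVneq (l i) 0; first by rewrite mulmx0 !scaler0.
by rewrite invfM mulrA mulfV// mul1r.
Qed.

Lemma scaled_row_bounded i : fdot (scaled_row i) (scaled_row i) <= k%:R / s%:R.
Proof.
rewrite fdotZl fdotZr fdot_row mulrA -invfM -expr2.
rewrite sqr_sqrtr ?pick_weight_ge0//.
have [->|li] := eqVneq (l i) 0; first by rewrite !mul0r mulr0 divr_ge0.
by rewrite invfM mulrACA mulVf// mul1r mulrC.
Qed.

(** The product [X *m (sketch V w)^T *m (sketch V w *m V)] as a function of the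
    list of picks, see [sketch_mul]. *)
Definition sketched_product m (X : 'M[R]_(m, p)) ws : 'M[R]_(m, k) :=
  \sum_(i <- ws) (l i * s%:R)^-1 *: (col i X *m row i V).

(** The sketched product of two matrices whose product is 0 is small: it is a
    sum of independent centered terms, and a row of [V] of small norm has a
    small probability. *)
Lemma sketched_product_mean m (X : 'M[R]_(m, p)) : X *m V = 0 ->
  iidE l s (fun ws => fdot (sketched_product X ws) (sketched_product X ws)) <=
    k%:R / s%:R * fdot X X.
Proof.
move=> XV; set Y := fun i => (l i * s%:R)^-1 *: (col i X *m row i V).
have sn0 : s%:R != 0 :> R by rewrite pnatr_eq0 -lt0n.
rewrite (iidE_sum_centered leverage_sum1 s (Y := Y)); last first.
  transitivity (s%:R^-1 *: (X *m V)); last by rewrite XV scaler0.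
  have -> : X *m V = \sum_i col i X *m row i V.
    apply/matrixP => a b; rewrite mxE summxE; apply: eq_bigr => i _.
    by rewrite [RHS]mxE big_ord1 !mxE.
  rewrite scaler_sumr; apply: eq_bigr => i _; rewrite scalerA.
  have [/row_eq0->|li] := eqVneq (l i) 0; first by rewrite mulmx0 !scaler0.
  by rewrite invfM mulrA mulfV// mul1r.
have XE : fdot X X = \sum_i fdot (col i X) (col i X).
  rewrite -fdot_tr fdotE; apply: eq_bigr => i _.
  by rewrite fdotE exchange_big big_ord1; apply: eq_bigr => j _; rewrite !mxE.
rewrite XE !mulr_sumr; apply: ler_sum => i _.
rewrite /Y fdotZl fdotZr.
have -> : fdot (col i X *m row i V) (col i X *m row i V) =
    fdot (col i X) (col i X) * (l i * k%:R).
  rewrite -fdot_row fdotMr -[X in _ *m X *m _]trmxK outer_mulmx.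
  by rewrite fdotZr mulrC.
have [->|li] := eqVneq (l i) 0.
  by rewrite !mul0r !mulr0 mulr_ge0 ?divr_ge0 ?fdot_ge0.
rewrite le_eqVlt; apply/orP; left; apply/eqP; field.
by rewrite li sn0.
Qed.

End Leverage.

Section LeverageLowerTail.
Variables (R : realType) (p k s q : nat) (V : 'M[R]_(p, k)) (d : R).
Hypothesis V_orth : V^T *m V = 1%:M.
Hypothesis k_gt0 : (0 < k)%N.
Hypothesis s_gt0 : (0 < s)%N.
Hypothesis q_gt0 : (0 < q)%N.
Hypothesis k_le : (k <= 2 ^ q.*2)%N.
Hypothesis d01 : 0 < d <= 1.

Local Notation eta := (d ^+ 2 / 192).

Hypothesis s_large : 2 * (q.*2)%:R * (k%:R / s%:R) <= eta.

Definition sketch_potential (ws : seq 'I_p) : R :=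
  (2 * eta) ^+ q.*2 * \tr (resolvent (scaled_row s V) eta ws ^+ q.*2).

(** Matrix Chernoff bound, lower tail, in the form needed for Markov's
    inequality.  With [kappa = d / 8], the threshold [tau = 3 / kappa] of the
    drift makes the initial potential decay below the floor within [s] picks,
    because [1 - b <= expR (- b)] and [kappa^-1 <= expR (tau / 3)]. *)
Lemma sketch_potential_mean :
  iidE (leverage V) s sketch_potential <= d.
Proof.
have /andP[d_gt0 d_le1] := d01.
set kappa := d / 8; set tau := 3 / kappa; set pp := q.*2.
have pp_gt0 : (0 < pp)%N by rewrite double_gt0.
have kappa_gt0 : 0 < kappa by rewrite divr_gt0.
have tau_gt0 : 0 < tau by rewrite divr_gt0.
have eta_gt0 : 0 < eta by rewrite divr_gt0// exprn_gt0.
have etaE : eta = kappa / tau.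
  by rewrite /tau /kappa; field; rewrite lt0r_neq0.
have s_gt0R : 0 < s%:R :> R by rewrite ltr0n.
set beta := pp%:R / 3 * s%:R^-1 * tau.
have beta_ge0 : 0 <= beta by rewrite !mulr_ge0// ?invr_ge0 ltW.
have beta_le1 : beta <= 1.
  apply: (@le_trans _ _ (2 * pp%:R * (k%:R / s%:R) / eta)); last first.
    by rewrite ler_pdivrMr// mul1r.
  have -> : 2 * pp%:R * (k%:R / s%:R) / eta = beta * (6 * k%:R / kappa).
    by rewrite etaE /beta; field; rewrite !lt0r_neq0.
  rewrite ler_peMr// ler_pdivlMr// mul1r.
  have : 1 <= k%:R :> R by rewrite (ler_nat R 1).
  rewrite /kappa; move: d_le1; lra.
have := potential_mean (leverage_ge0 V) (leverage_sum1 V_orth k_gt0) eta_gt0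
  (scaled_row_isotropic s V_orth k_gt0)
  (scaled_row_bounded s V k_gt0) s_large pp_gt0 tau_gt0 _ s beta_le1.
rewrite invr_ge0 ltW// => /(_ isT).
rewrite -/pp -/beta => mean.
apply: le_trans (_ : (2 * eta) ^+ pp * (2 * (k%:R * tau ^+ pp)) <= d); last first.
  have -> : (2 * eta) ^+ pp * (2 * (k%:R * tau ^+ pp)) =
      2 * k%:R * (d / 4) ^+ pp.
    have -> : d / 4 = 2 * eta * tau.
      by rewrite etaE /kappa; field; rewrite lt0r_neq0.
    by rewrite [in RHS]exprMn; ring.
  have k_leR : k%:R <= 2 ^+ pp :> R by rewrite -natrX ler_nat.
  have pow_le (x : R) : 0 <= x <= 1 -> x ^+ pp <= x.
    by case/andP=> x0 x1; rewrite -[leRHS]expr1 ler_wiXn2l.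
  apply: (@le_trans _ _ (2 * 2 ^+ pp * (d / 4) ^+ pp)).
    by rewrite ler_wpM2r ?ler_wpM2l// exprn_ge0// divr_ge0// ltW.
  rewrite -mulrA -exprMn.
  apply: (@le_trans _ _ (2 * (2 * (d / 4)))); last lra.
  by rewrite ler_wpM2l// pow_le//; move: d_le1; lra.
rewrite /sketch_potential iidEZ ler_wpM2l//.
  by rewrite exprn_ge0// mulr_ge0// ltW.
apply: (le_trans mean); rewrite mulrDl mul1r lerD2r mulrCA ler_wpM2l//.
have decay : (1 - beta) ^+ s <= kappa ^+ pp.
  have one_sub : 1 - beta <= expR (- beta) := expR_ge1Dx _.
  apply: (@le_trans _ _ (expR (- beta) ^+ s)).
    by rewrite lerXn2r ?nnegrE ?subr_ge0 ?expR_ge0.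
  rewrite -expRM_natl.
  have -> : s%:R * - beta = pp%:R * - (tau / 3).
    by rewrite /beta; field; rewrite lt0r_neq0.
  rewrite expRM_natl lerXn2r ?nnegrE ?expR_ge0 ?(ltW kappa_gt0)// expRN.
  rewrite -[leRHS]invrK lef_pV2 ?posrE ?expR_gt0 ?invr_gt0//.
  have -> : kappa^-1 = tau / 3 by rewrite /tau; field; rewrite lt0r_neq0.
  by apply: le_trans (expR_ge1Dx _); rewrite lerDr.
apply: le_trans (ler_wpM2r _ decay) _.
  by rewrite exprn_ge0// invr_ge0 ltW.
by rewrite -exprMn etaE invf_div [_ * (_ / _)]mulrC divfK ?lt0r_neq0.
Qed.

End LeverageLowerTail.

(** * Sketched regression as an oblique projection *)

Section Pseudoinverse.
Variable R : realType.

Lemma pinv_eq m n (A : 'M[R]_(m, n)) B : penrose A B -> pinv A = B.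
Proof. by move=> AB; apply: penrose_unique AB; apply: pinvP. Qed.

Lemma pinv_tr m n (A : 'M[R]_(m, n)) : pinv A^T = (pinv A)^T.
Proof.
have [p1 p2 p3 p4] := pinvP A; apply: pinv_eq; split.
- by rewrite -!trmx_mul mulmxA p1.
- by rewrite -!trmx_mul mulmxA p2.
- by rewrite -trmx_mul p4.
- by rewrite -trmx_mul p3.
Qed.

Lemma pinv_mul_unit m k (F : 'M[R]_(m, k)) (T : 'M[R]_k) :
    F^T *m F \in unitmx -> T \in unitmx ->
  pinv (F *m T) = invmx T *m invmx (F^T *m F) *m F^T.
Proof.
move=> uF uT; have uTT : T *m T^T \in unitmx.
  by rewrite unitmx_mul unitmx_tr uT.
rewrite (pinv_eq (penrose_mul uF uTT)); congr (_ *m _ *m _).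
by rewrite -[LHS](mulKmx uT) [T *m (_ *m _)]mulmxA mulmxV// mulmx1.
Qed.

End Pseudoinverse.

Section OrthonormalColumns.
Variables (R : realType) (m k : nat) (U : 'M[R]_(m, k)).
Hypothesis U_orth : U^T *m U = 1%:M.

Lemma fdot_orth q (X Y : 'M[R]_(k, q)) : fdot (U *m X) (U *m Y) = fdot X Y.
Proof. by rewrite fdotMl mulmxA U_orth mul1mx. Qed.

Lemma orthonormal_colbasis_factor (M : 'M[R]_(m, k)) :
  \rank M = k -> (U^T :=: M^T)%MS -> exists2 T, T \in unitmx & M = U *m T.
Proof.
move=> rkM UM; have /submxP[D MD] : (M^T <= U^T)%MS by rewrite UM.
have ME : M = U *m D^T by rewrite -[LHS]trmxK MD trmx_mul trmxK.
exists D^T => //; rewrite -row_free_unit /row_free eqn_leq rank_leq_row /=.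
by rewrite -[X in (X <= _)%N]rkM ME mxrankM_maxr.
Qed.

End OrthonormalColumns.

Section SketchedRegression.
Variables (R : realType) (m n c r : nat).
Variables (A : 'M[R]_(m, n)) (U : 'M[R]_(m, c)) (W : 'M[R]_(n, r)).
Hypothesis U_orth : U^T *m U = 1%:M.
Hypothesis W_orth : W^T *m W = 1%:M.
Variables (TM : 'M[R]_c) (TN : 'M[R]_r).
Hypothesis TM_unit : TM \in unitmx.
Hypothesis TN_unit : TN \in unitmx.

Local Notation M := (U *m TM).
Local Notation N := ((W *m TN)^T).

(** The coordinates, in the bases [U] and [W], of the best approximation. *)
Definition core := U^T *m A *m W.
Definition remainder := A - U *m core *m W^T.
Local Notation B := remainder.

(** The coordinates of the remainder along the columns of [U] and along the rows
    of [W^T], and the part orthogonal to both. *)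
Definition left_part := U^T *m B.
Definition right_part := B *m W.
Definition perp_part := B - U *m left_part - right_part *m W^T.

Lemma left_part_orth : left_part *m W = 0.
Proof.
rewrite /left_part /remainder mulmxBr mulmxBl !mulmxA U_orth mul1mx.
by rewrite -!mulmxA W_orth mulmx1 mulmxA subrr.
Qed.

Lemma right_part_orth : right_part^T *m U = 0.
Proof.
apply: trmx_inj; rewrite trmx_mul trmxK trmx0 mulmxA; exact: left_part_orth.
Qed.

Lemma perp_part_orthl : U^T *m perp_part = 0.
Proof.
rewrite /perp_part 2!mulmxBr [U^T *m (U *m _)]mulmxA U_orth mul1mx.
rewrite -/left_part subrr sub0r.
by rewrite /right_part !mulmxA left_part_orth mul0mx oppr0.
Qed.

Lemma perp_part_orthr : perp_part *m W = 0.
Proof.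
rewrite /perp_part 2!mulmxBl -(mulmxA U) left_part_orth mulmx0 subr0.
by rewrite -(mulmxA right_part) W_orth mulmx1 subrr.
Qed.

Lemma remainderE : B = U *m left_part + right_part *m W^T + perp_part.
Proof.
rewrite /perp_part; move: (U *m _) (_ *m W^T) => X Y.
by rewrite addrC -[_ - _]addrA -opprD subrK.
Qed.

Lemma fdot_remainder : fdot B B =
  fdot left_part left_part + fdot right_part right_part +
  fdot perp_part perp_part.
Proof.
rewrite {1 2}remainderE !fdotDD fdotDl fdot_orth//.
have -> : fdot (right_part *m W^T) (right_part *m W^T) =
    fdot right_part right_part.
  by rewrite fdotMr trmxK -mulmxA W_orth mulmx1.
have -> : fdot (U *m left_part) (right_part *m W^T) = 0.
  rewrite fdotMl mulmxA /right_part mulmxA -/left_part left_part_orth mul0mx.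
  exact: fdot0r.
have -> : fdot (U *m left_part) perp_part = 0.
  by rewrite fdotMl perp_part_orthl fdot0r.
have -> : fdot (right_part *m W^T) perp_part = 0.
  by rewrite fdotMr trmxK perp_part_orthr fdot0r.
by ring.
Qed.

(** Pythagoras: the remainder is orthogonal to all [U *m Y *m W^T]. *)
Lemma fdot_residual Y :
  fdot (A - U *m Y *m W^T) (A - U *m Y *m W^T) =
    fdot B B + fdot (Y - core) (Y - core).
Proof.
have -> : A - U *m Y *m W^T = B + U *m (core - Y) *m W^T.
  by rewrite mulmxBr mulmxBl /remainder addrA subrK.
have fdotW q (X1 X2 : 'M_(q, r)) : fdot (X1 *m W^T) (X2 *m W^T) = fdot X1 X2.
  by rewrite fdotMr trmxK -mulmxA W_orth mulmx1.
rewrite fdotDD fdotW fdot_orth// -[core - Y]opprB fdotNl fdotNr opprK.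
suff -> : fdot B (U *m - (Y - core) *m W^T) = 0 by rewrite mulr0 addr0.
rewrite fdotC fdotMr trmxK fdotMl mulmxA -/left_part.
by rewrite left_part_orth fdot0r.
Qed.

Section Sketched.
Variables (sc sr : nat) (SM : 'M[R]_(sc, m)) (SN : 'M[R]_(sr, n)) (eta : R).
Local Notation GM := ((SM *m U)^T *m (SM *m U)).
Local Notation GN := ((SN *m W)^T *m (SN *m W)).
Hypothesis eta_gt0 : 0 < eta.
Hypothesis eta_le1 : eta <= 1.
Hypothesis GM_ge : forall q (X : 'M_(c, q)), eta * fdot X X <= fdot X (GM *m X).
Hypothesis GN_ge : forall q (X : 'M_(r, q)), eta * fdot X X <= fdot X (GN *m X).

(** The coordinates of the sketched approximation, see [mulmx_Xhat]. *)
Definition sketched_core :=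
  invmx GM *m (SM *m U)^T *m SM *m A *m SN^T *m (SN *m W) *m invmx GN.

Lemma mulmx_Xhat : M *m Xhat SM SN A M N *m N = U *m sketched_core *m W^T.
Proof.
have uM := coercive_unit eta_gt0 GM_ge; have uN := coercive_unit eta_gt0 GN_ge.
have -> : Xhat SM SN A M N = invmx TM *m sketched_core *m (invmx TN)^T.
  have invGNT : (invmx GN)^T = invmx GN.
    by rewrite trmx_inv [GN^T]trmx_mul trmxK.
  rewrite /Xhat -trmx_mul pinv_tr (mulmxA SM) (mulmxA SN) !pinv_mul_unit//.
  rewrite (trmx_mul (_ *m _) (SN *m W)^T) trmxK (trmx_mul (invmx TN)) invGNT.
  by rewrite /sketched_core !mulmxA.
rewrite trmx_mul !mulmxA mulmxK// -(mulmxA _ _ TN^T) -trmx_mul mulmxV//.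
by rewrite trmx1 mulmx1.
Qed.

(** The sketched projections fix [U] and [W], so only the remainder
    contributes, and one of the two sketches cancels on each of its first two
    parts. *)
Lemma sketched_coreE : sketched_core - core =
  left_part *m SN^T *m (SN *m W) *m invmx GN +
  invmx GM *m (right_part^T *m SM^T *m (SM *m U))^T +
  invmx GM *m ((perp_part *m SN^T *m (SN *m W))^T *m SM^T *m (SM *m U))^T
    *m invmx GN.
Proof.
have uM := coercive_unit eta_gt0 GM_ge; have uN := coercive_unit eta_gt0 GN_ge.
pose PM := invmx GM *m (SM *m U)^T *m SM.
pose PN := SN^T *m (SN *m W) *m invmx GN.
have PMU : PM *m U = 1%:M by rewrite -!mulmxA mulVmx.
have PNW : W^T *m PN = 1%:M.
  by rewrite /PN -(mulmxA SN^T) mulmxA -trmx_mul mulmxA mulmxV.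
have -> : sketched_core = PM *m A *m PN.
  by rewrite /sketched_core /PM /PN !mulmxA.
have -> : A = U *m core *m W^T + B by rewrite /remainder addrC subrK.
have fixU q (X : 'M_(c, q)) : PM *m (U *m X) = X by rewrite mulmxA PMU mul1mx.
have fixW q (X : 'M_(q, r)) : X *m W^T *m PN = X.
  by rewrite -mulmxA PNW mulmx1.
rewrite mulmxDr -(mulmxA U) fixU mulmxDl fixW addrC addKr remainderE.
move: left_part right_part perp_part => X1 X2 X3.
rewrite !(mulmxDr PM) !(mulmxDl _ _ PN) fixU (mulmxA PM X2) fixW.
congr (_ + _ + _); first by rewrite /PN !mulmxA.
  rewrite (trmx_mul (_ *m SM^T)) (trmx_mul X2^T) !trmxK /PM.
  by rewrite !mulmxA.
rewrite (trmx_mul (_ *m SM^T)) (trmx_mul (_ *m (SN *m W))^T) !trmxK /PM /PN.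
by rewrite !mulmxA.
Qed.

(** The inverse Gram matrices cost a factor [eta^-2] each on squared norms. *)
Lemma sketched_core_le :
  eta ^+ 4 * fdot (sketched_core - core) (sketched_core - core) <=
  4 * (fdot (left_part *m SN^T *m (SN *m W)) (left_part *m SN^T *m (SN *m W)) +
       fdot (right_part^T *m SM^T *m (SM *m U))
            (right_part^T *m SM^T *m (SM *m U)) +
       fdot ((perp_part *m SN^T *m (SN *m W))^T *m SM^T *m (SM *m U))
            ((perp_part *m SN^T *m (SN *m W))^T *m SM^T *m (SM *m U))).
Proof.
rewrite sketched_coreE.
set Y1 := left_part *m _ *m _; set Y2 := right_part^T *m _ *m _.
set Y3 := _ *m _ *m (SM *m U).
have GNT : GN^T = GN by rewrite trmx_mul trmxK.
have invM q (X : 'M_(c, q)) :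
    eta ^+ 2 * fdot (invmx GM *m X) (invmx GM *m X) <= fdot X X.
  exact: fdot_coercive_inv.
have invN q (X : 'M_(q, r)) :
    eta ^+ 2 * fdot (X *m invmx GN) (X *m invmx GN) <= fdot X X.
  rewrite -fdot_tr trmx_mul trmx_inv GNT -(fdot_tr X); exact: fdot_coercive_inv.
set Z1 := Y1 *m _; set Z2 := invmx GM *m Y2^T; set Z3 := _ *m invmx GN.
have e2_gt0 : 0 < eta ^+ 2 by rewrite exprn_gt0.
have e2_le1 : eta ^+ 2 <= 1 by rewrite expr_le1// ltW.
have shrink (x : R) : 0 <= x -> eta ^+ 4 * x <= eta ^+ 2 * x.
  by move=> x0; rewrite ler_wpM2r// ler_wiXn2l// ltW.
have H1 : eta ^+ 4 * fdot Z1 Z1 <= fdot Y1 Y1.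
  by apply: le_trans (shrink _ (fdot_ge0 _)) (invN _ _).
have H2 : eta ^+ 4 * fdot Z2 Z2 <= fdot Y2 Y2.
  by rewrite -(fdot_tr Y2); apply: le_trans (shrink _ (fdot_ge0 _)) (invM _ _).
have H3 : eta ^+ 4 * fdot Z3 Z3 <= fdot Y3 Y3.
  rewrite (exprD _ 2 2) -mulrA -(fdot_tr Y3).
  apply: (@le_trans _ _ (eta ^+ 2 *
      fdot (invmx GM *m Y3^T) (invmx GM *m Y3^T))).
    by rewrite ler_pM2l ?invN.
  exact: invM.
have e4_ge0 : 0 <= eta ^+ 4 by rewrite exprn_ge0// ltW.
have := ler_wpM2l e4_ge0 (fdotD_le (Z1 + Z2) Z3).
have := ler_wpM2l e4_ge0 (fdotD_le Z1 Z2).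
have := mulr_ge0 e4_ge0 (fdot_ge0 Z3).
move: H1 H2 H3; move: (eta ^+ 4) => e; lra.
Qed.

End Sketched.

(** The exact solution is the sketched one for identity sketches. *)
Lemma mulmx_Xstar : M *m Xstar A M N *m N = U *m core *m W^T.
Proof.
have -> : Xstar A M N = Xhat 1%:M 1%:M A M N.
  by rewrite /Xstar /Xhat trmx1 !mul1mx !mulmx1.
have id_ge k (Y : 'M[R]_k) :
    Y = 1%:M -> forall q (Z : 'M_(k, q)), 1 * fdot Z Z <= fdot Z (Y *m Z).
  by move=> -> q Z; rewrite mul1r mul1mx.
rewrite (@mulmx_Xhat _ _ _ _ 1)//; last 2 first.
- by apply: id_ge; rewrite mul1mx.
- by apply: id_ge; rewrite mul1mx.
congr (_ *m _ *m _); rewrite /sketched_core !mul1mx U_orth W_orth trmx1.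
by rewrite !invmx1 !mul1mx !mulmx1.
Qed.

Lemma residualE X : residual A M N X =
  Num.sqrt (fdot (A - M *m X *m N) (A - M *m X *m N)).
Proof.
by rewrite /residual /frob fdotE.
Qed.

Lemma residual_Xstar : residual A M N (Xstar A M N) = Num.sqrt (fdot B B).
Proof. by rewrite residualE mulmx_Xstar. Qed.

Lemma residual_Xstar_le X :
  residual A M N (Xstar A M N) <= residual A M N X.
Proof.
rewrite residual_Xstar residualE ler_wsqrtr//.
have -> : M *m X *m N = U *m (TM *m X *m TN^T) *m W^T.
  by rewrite trmx_mul !mulmxA.
by rewrite fdot_residual lerDl fdot_ge0.
Qed.

End SketchedRegression.

(** * Probability of a good approximation *)

Section TwoSamples.
Variables (R : realType) (p1 k1 s1 p2 k2 s2 : nat).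
Variables (V1 : 'M[R]_(p1, k1)) (V2 : 'M[R]_(p2, k2)).
Hypothesis V1_orth : V1^T *m V1 = 1%:M.
Hypothesis V2_orth : V2^T *m V2 = 1%:M.
Hypothesis k1_gt0 : (0 < k1)%N.
Hypothesis k2_gt0 : (0 < k2)%N.

Definition iidE2 (F : seq 'I_p1 -> seq 'I_p2 -> R) : R :=
  iidE (leverage V2) s2 (fun ws2 =>
    iidE (leverage V1) s1 (fun ws1 => F ws1 ws2)).

Lemma iidE2_picks F : iidE2 F =
  \sum_(w : picks p1 s1 * picks p2 s2)
    pick_prob V1 w.1 * pick_prob V2 w.2 * F (codom w.1) (codom w.2).
Proof.
rewrite /iidE2 -iidE_ffun.
rewrite -(pair_bigA _ (fun w1 w2 =>
  pick_prob V1 w1 * pick_prob V2 w2 * F (codom w1) (codom w2))) exchange_big /=.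
apply: eq_bigr => w2 _; rewrite -iidE_ffun mulr_sumr.
by apply: eq_bigr => w1 _; rewrite mulrA [_ * pick_prob _ _]mulrC.
Qed.

Lemma pick_prob_ge0 p k s (V : 'M[R]_(p, k)) (w : picks p s) :
  0 <= pick_prob V w.
Proof. by apply: prodr_ge0 => j _; apply: leverage_ge0. Qed.

(** Markov's inequality. *)
Lemma Pr2_ge (E : picks p1 s1 -> picks p2 s2 -> bool) F :
    (forall ws1 ws2, 0 <= F ws1 ws2) ->
    (forall w1 w2, ~~ E w1 w2 -> 1 <= F (codom w1) (codom w2)) ->
  1 - iidE2 F <= Pr2 V1 V2 E.
Proof.
move=> F_ge0 F_ge1; set q := fun w : picks p1 s1 * picks p2 s2 =>
  pick_prob V1 w.1 * pick_prob V2 w.2.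
have q_ge0 w : 0 <= q w by rewrite mulr_ge0 ?pick_prob_ge0.
have q_sum : \sum_w q w = 1.
  transitivity (iidE2 (fun _ _ => 1)).
    by rewrite iidE2_picks; apply: eq_bigr => w _; rewrite mulr1.
  by rewrite /iidE2 !iidE_cst ?leverage_sum1.
rewrite lerBlDr -q_sum (bigID (fun w => E w.1 w.2)) /= lerD2l iidE2_picks.
rewrite [leRHS](bigID (fun w => E w.1 w.2)) /=.
apply: ler_wpDl.
  by rewrite sumr_ge0// => w _; rewrite mulr_ge0 ?q_ge0.
by apply: ler_sum => w nE; rewrite ler_peMr ?q_ge0 ?F_ge1.
Qed.

End TwoSamples.

Section Success.
Variables (R : realType) (m n c r : nat).
Variables (A : 'M[R]_(m, n)) (U : 'M[R]_(m, c)) (W : 'M[R]_(n, r)).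
Hypothesis U_orth : U^T *m U = 1%:M.
Hypothesis W_orth : W^T *m W = 1%:M.
Variables (TM : 'M[R]_c) (TN : 'M[R]_r).
Hypothesis TM_unit : TM \in unitmx.
Hypothesis TN_unit : TN \in unitmx.
Variables (sc sr qc qr : nat) (delta eps : R).
Hypothesis delta01 : 0 < delta <= 1.
Hypothesis eps01 : 0 < eps < 1.
Hypothesis c_gt0 : (0 < c)%N.
Hypothesis r_gt0 : (0 < r)%N.
Hypothesis sc_gt0 : (0 < sc)%N.
Hypothesis sr_gt0 : (0 < sr)%N.
Hypothesis qc_gt0 : (0 < qc)%N.
Hypothesis qr_gt0 : (0 < qr)%N.
Hypothesis c_le : (c <= 2 ^ qc.*2)%N.
Hypothesis r_le : (r <= 2 ^ qr.*2)%N.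

(* [eta] bounds the eigenvalues of the sketched Gram matrices from below, except
   with probability [delta / 4] each; [theta] then makes the noise, amplified by
   [eta ^- 4], small against [eps * sqnorm B] except with probability
   [delta / 2]. *)
Local Notation eta := ((delta / 4) ^+ 2 / 192).
Local Notation theta := (delta * eta ^+ 4 / 4).

Hypothesis sc_large : 2 * (qc.*2)%:R * (c%:R / sc%:R) <= eta.
Hypothesis sr_large : 2 * (qr.*2)%:R * (r%:R / sr%:R) <= eta.
Hypothesis sc_eps : c%:R / sc%:R <= theta * eps.
Hypothesis sr_eps : r%:R / sr%:R <= theta * eps.

Lemma eta_gt0 : 0 < eta.
Proof.
by have /andP[d0 _] := delta01; rewrite !divr_gt0 ?exprn_gt0 ?divr_gt0.
Qed.

Lemma eta_le1 : eta <= 1.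
Proof.
have /andP[d0 d1] := delta01.
have : (delta / 4) ^+ 2 <= 1 by rewrite expr_le1//; move: d0 d1; lra.
lra.
Qed.

Lemma theta_gt0 : 0 < theta.
Proof.
have /andP[d0 _] := delta01.
by rewrite divr_gt0// mulr_gt0// exprn_gt0// eta_gt0.
Qed.

Lemma thetaeps_le1 : theta * eps <= 1.
Proof.
have /andP[d0 d1] := delta01; have /andP[e0 e1] := eps01.
have eta4_ge0 : 0 <= eta ^+ 4 by rewrite exprn_ge0// ltW// eta_gt0.
have eta4_le1 : eta ^+ 4 <= 1.
  by rewrite expr_le1// ?eta_le1//; apply: ltW eta_gt0.
apply: mulr_ile1; [exact: ltW theta_gt0|exact: ltW| |exact: ltW].
have : delta * eta ^+ 4 <= 1 by apply: mulr_ile1 => //; apply: ltW.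
lra.
Qed.

Local Notation M := (U *m TM).
Local Notation N := ((W *m TN)^T).
Local Notation B := (remainder A U W).
Local Notation sqnorm X := (fdot X X).

Lemma sketched_product0 p k s d (V : 'M[R]_(p, k)) ws :
  sketched_product s V (0 : 'M_(d, p)) ws = 0.
Proof. by apply: big1 => i _; rewrite colE !mul0mx scaler0. Qed.

(** The squared norms on the right of [sketched_core_le]. *)
Definition sketch_noise ws1 ws2 : R :=
  sqnorm (sketched_product sr W (left_part A U W) ws2) +
  sqnorm (sketched_product sc U (right_part A U W)^T ws1) +
  sqnorm (sketched_product sc U
    (sketched_product sr W (perp_part A U W) ws2)^T ws1).

(** Conditionally on the picks for [N], the last term is again the sketched
    product of two matrices whose product is 0. *)
Lemma sketch_noise_mean :
  iidE2 sc sr U W sketch_noise <= theta * eps * sqnorm B.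
Proof.
have thetaeps_ge0 : 0 <= theta * eps.
  by apply: le_trans sc_eps; rewrite divr_ge0.
set L := left_part A U W; set Q := right_part A U W; set Z := perp_part A U W.
have LW : L *m W = 0 by exact: left_part_orth.
have QU : Q^T *m U = 0 by exact: right_part_orth.
have ZU ws2 : (sketched_product sr W Z ws2)^T *m U = 0.
  have UZ : U^T *m Z = 0 by exact: perp_part_orthl.
  apply: trmx_inj; rewrite trmx_mul trmxK trmx0 /sketched_product mulmx_sumr.
  apply: big1 => i _; rewrite -scalemxAr colE !mulmxA UZ.
  by rewrite !mul0mx scaler0.
have ZW : Z *m W = 0 by exact: perp_part_orthr.
have r_le1 : r%:R / sr%:R <= 1 :> R.
  exact: le_trans sr_eps thetaeps_le1.
rewrite /iidE2 /sketch_noise -/L -/Q -/Z.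
pose f1 ws2 : R := sqnorm (sketched_product sr W L ws2).
pose f2 ws1 : R := sqnorm (sketched_product sc U Q^T ws1).
pose f3 ws2 : R := sqnorm (sketched_product sr W Z ws2).
have le1 := sketched_product_mean W_orth r_gt0 sr_gt0 LW.
have le2 := sketched_product_mean U_orth c_gt0 sc_gt0 QU.
have le3 := sketched_product_mean W_orth r_gt0 sr_gt0 ZW.
apply: (@le_trans _ _ (iidE (leverage W) sr (fun ws2 =>
   f1 ws2 + (c%:R / sc%:R * sqnorm Q + theta * eps * f3 ws2)))).
  apply: (iidE_le (leverage_ge0 W)) => ws2.
  rewrite !iidED (iidE_cst (leverage_sum1 U_orth c_gt0)) -addrA lerD2l.
  apply: lerD; first by rewrite -(fdot_tr Q).
  apply: le_trans (sketched_product_mean U_orth c_gt0 sc_gt0 (ZU ws2)) _.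
  by rewrite fdot_tr ler_wpM2r ?fdot_ge0.
rewrite !iidED iidE_cst ?leverage_sum1// iidEZ (fdot_remainder _ U_orth W_orth).
rewrite -/L -/Q -/Z !mulrDr -!addrA; apply: lerD.
  by apply: le_trans le1 _; rewrite ler_wpM2r ?fdot_ge0.
apply: lerD; first by rewrite ler_wpM2r ?fdot_ge0.
rewrite ler_wpM2l//; apply: le_trans le3 _.
by rewrite ler_piMl ?fdot_ge0.
Qed.

Local Notation potM := (sketch_potential sc qc U (delta / 4)).
Local Notation potN := (sketch_potential sr qr W (delta / 4)).
Local Notation threshold := (eps * eta ^+ 4 / 2 * sqnorm B).

Lemma sketch_gram_ge p k s q (V : 'M[R]_(p, k)) (w : picks p s) :
    (0 < q)%N -> sketch_potential s q V (delta / 4) (codom w) <= 1 ->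
  forall d (X : 'M_(k, d)),
    eta * sqnorm X <= fdot X ((sketch V w *m V)^T *m (sketch V w *m V) *m X).
Proof.
move=> q_gt0 small d X; rewrite sketch_gram; apply: (gram_sum_ge eta_gt0 q_gt0).
have pow_gt0 : 0 < (2 * eta) ^+ q.*2 by rewrite exprn_gt0// mulr_gt0// eta_gt0.
by rewrite exprVn -[leRHS]mul1r ler_pdivlMr// mulrC.
Qed.

Lemma residual_Xhat_le (wM : picks m sc) (wN : picks n sr) :
    potM (codom wM) <= 1 -> potN (codom wN) <= 1 ->
    sketch_noise (codom wM) (codom wN) <= threshold ->
  residual A M N (Xhat (sketch U wM) (sketch W wN) A M N) <=
    (1 + eps) * residual A M N (Xstar A M N).
Proof.
move=> goodM goodN noise; have /andP[e0 e1] := eps01.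
have geM := sketch_gram_ge qc_gt0 goodM.
have geN := sketch_gram_ge qr_gt0 goodN.
rewrite residual_Xstar// residualE.
rewrite (mulmx_Xhat _ TM_unit TN_unit eta_gt0 geM geN).
have -> : (1 + eps) * Num.sqrt (sqnorm B) =
    Num.sqrt ((1 + eps) ^+ 2 * sqnorm B).
  by rewrite sqrtrM ?sqr_ge0// sqrtr_sqr ger0_norm// addr_ge0// ltW.
rewrite ler_wsqrtr// fdot_residual//.
set D := _ - core _ _ _.
have D_le : sqnorm D <= 2 * eps * sqnorm B.
  have eta4_gt0 : 0 < eta ^+ 4 by rewrite exprn_gt0// eta_gt0.
  rewrite -(ler_pM2l eta4_gt0).
  apply: le_trans (sketched_core_le A eta_gt0 eta_le1 geM geN) _.
  rewrite !sketch_mul; move: noise; rewrite /sketch_noise /sketched_product; lra.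
have : 0 <= eps ^+ 2 * sqnorm B by rewrite mulr_ge0 ?sqr_ge0 ?fdot_ge0.
rewrite sqrrD; lra.
Qed.

Lemma sketch_potential_ge0 p k s q (V : 'M[R]_(p, k)) ws :
  0 <= sketch_potential s q V (delta / 4) ws.
Proof.
apply: mulr_ge0.
  by rewrite exprn_ge0// mulr_ge0// ltW// eta_gt0.
have [_] := psdX q.*2 (psd_resolvent (scaled_row s V) eta_gt0 ws).
by move=> /(_ _ 1%:M); rewrite /fdot trmx1 mul1mx mulmx1.
Qed.

(** Failure forces one of three nonnegative quantities, the two potentials and the
    noise divided by the threshold, to be at least 1, and their means are at most
    [delta / 4], [delta / 4] and [delta / 2]. *)
Lemma success_probability :
  1 - delta <= Pr2 U W (fun (wM : picks m sc) (wN : picks n sr) =>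
    residual A M N (Xhat (sketch U wM) (sketch W wN) A M N)
      <= (1 + eps) * residual A M N (Xstar A M N)).
Proof.
have /andP[d0 d1] := delta01; have /andP[e0 e1] := eps01.
have thr_ge0 : 0 <= threshold.
  rewrite mulr_ge0 ?fdot_ge0// divr_ge0// mulr_ge0 ?(ltW e0)// exprn_ge0//.
  by rewrite ltW// eta_gt0.
have noise_ge0 ws1 ws2 : 0 <= sketch_noise ws1 ws2.
  by rewrite !addr_ge0 ?fdot_ge0.
pose F ws1 ws2 := potM ws1 + potN ws2 + threshold^-1 * sketch_noise ws1 ws2.
apply: le_trans (Pr2_ge U_orth W_orth c_gt0 r_gt0 (F := F) _ _).
- rewrite lerD2l lerN2.
  have mean1 : iidE (leverage U) sc potM <= delta / 4.
    by apply: sketch_potential_mean => //; move: d0 d1; lra.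
  have mean2 : iidE (leverage W) sr potN <= delta / 4.
    by apply: sketch_potential_mean => //; move: d0 d1; lra.
  have mean3 : threshold^-1 * iidE2 sc sr U W sketch_noise <= delta / 2.
    apply: le_trans (ler_wpM2l _ sketch_noise_mean) _; first by rewrite invr_ge0.
    have [->|Bn] := eqVneq (sqnorm B) 0; first by rewrite !mulr0 divr_ge0 ?ltW.
    rewrite le_eqVlt; apply/orP; left; apply/eqP.
    move: (sqnorm B) Bn => b bn; field.
    by rewrite bn !lt0r_neq0.
  have -> : iidE2 sc sr U W F = iidE (leverage U) sc potM +
      iidE (leverage W) sr potN + threshold^-1 * iidE2 sc sr U W sketch_noise.
    rewrite /iidE2 -iidEZ.
    rewrite -[X in X + _ + _](iidE_cst (leverage_sum1 W_orth r_gt0) sr).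
    rewrite -!iidED; apply: iidE_ext => ws2.
    rewrite /F 2!iidED iidE_cst ?leverage_sum1//.
    by rewrite [X in _ + _ + X]iidEZ.
  by move: mean1 mean2 mean3; lra.
- by move=> ws1 ws2; rewrite !addr_ge0 ?sketch_potential_ge0// mulr_ge0 ?invr_ge0.
move=> wM wN; apply: contraNT; rewrite -ltNge /F => F_lt1.
have pM := sketch_potential_ge0 sc qc U (codom wM).
have pN := sketch_potential_ge0 sr qr W (codom wN).
have nn := noise_ge0 (codom wM) (codom wN).
have tn : 0 <= threshold^-1 * sketch_noise (codom wM) (codom wN).
  by rewrite mulr_ge0 ?invr_ge0.
apply: residual_Xhat_le; [by move: F_lt1; lra|by move: F_lt1; lra|].
have [B0|Bn] := eqVneq (sqnorm B) 0.
  (* The threshold is 0 and [F] ignores the noise, which is 0 as well. *)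
  have {}B0 : B = 0 by apply/eqP; rewrite -fdot_eq0 B0.
  rewrite /sketch_noise /left_part /right_part /perp_part /left_part /right_part.
  rewrite B0 mulmx0 mul0mx mulmx0 mul0mx !subr0 trmx0 !sketched_product0.
  by rewrite trmx0 sketched_product0 !fdot0r !addr0 mulr0.
have thr_gt0 : 0 < threshold.
  have B_gt0 : 0 < sqnorm B by rewrite lt_def Bn fdot_ge0.
  by rewrite mulr_gt0// divr_gt0// mulr_gt0// exprn_gt0// eta_gt0.
by rewrite -[leRHS]mulr1 -ler_pdivrMl//; move: F_lt1; lra.
Qed.

End Success.

(** * Adding one column to a pseudoinverse *)

Section Greville.
Variables (R : realType) (s k : nat).
Variables (B : 'M[R]_(s, k)) (P : 'M[R]_(k, s)) (a : 'cV[R]_s) (e : 'cV[R]_k).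
Hypothesis BP : penrose B P.
Hypothesis e_unit : e^T *m e = 1%:M.
Hypothesis Be : B *m e = 0.

Local Notation d := (P *m a).
Local Notation u := (a - B *m (P *m a)).

(** The range of [P] is that of [B^T], which is orthogonal to the kernel of
    [B]. *)
Lemma Greville_row : e^T *m P = 0.
Proof.
have [_ p2 _ p4] := BP; rewrite -p2 -p4 trmx_mul !mulmxA -trmx_mul Be.
by rewrite trmx0 !mul0mx.
Qed.

Lemma Greville_proj : P *m B *m d = d.
Proof. by have [_ p2 _ _] := BP; rewrite !mulmxA p2. Qed.

Lemma Greville_range b : (B + a *m e^T) *m (P + (e - d) *m b) = B *m P + u *m b.
Proof.
have BaP : (B + a *m e^T) *m P = B *m P.
  by rewrite mulmxDl -mulmxA Greville_row mulmx0 addr0.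
have Bed : (B + a *m e^T) *m (e - d) = u.
  rewrite mulmxDl mulmxBr Be sub0r -(mulmxA a) mulmxBr e_unit.
  by rewrite (mulmxA e^T) Greville_row mul0mx subr0 mulmx1 addrC.
by rewrite mulmxDr BaP mulmxA Bed.
Qed.

(** The new column has a component [u] orthogonal to the range of [B].  The new
    pseudoinverse agrees with [P] on that range and maps [u] to its preimage
    [e - d]. *)
Lemma Greville_independent : u != 0 ->
  penrose (B + a *m e^T) (P + (e - d) *m ((fdot u u)^-1 *: u^T)).
Proof.
move=> u0; have [p1 p2 p3 p4] := BP.
have uu : fdot u u != 0 by rewrite fdot_eq0.
have uB : u^T *m B = 0.
  apply: trmx_inj; rewrite trmx_mul trmxK trmx0 mulmxBr !mulmxA.
  suff -> : B^T *m B *m P = B^T by rewrite subrr.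
  by rewrite -mulmxA -p3 -trmx_mul p1.
have ua : u^T *m a = (fdot u u)%:M.
  have aE : a = u + B *m d by rewrite subrK.
  by rewrite [X in u^T *m X]aE mulmxDr (mulmxA u^T) uB mul0mx addr0 trmx_mul_cV.
set b := _ *: u^T.
have bB : b *m B = 0 by rewrite -scalemxAl uB scaler0.
have ba : b *m a = 1%:M by rewrite -scalemxAl ua scale_scalar_mx mulVf.
have bBa : b *m (B + a *m e^T) = e^T.
  by rewrite mulmxDr bB add0r mulmxA ba mul1mx.
have dom : (P + (e - d) *m b) *m (B + a *m e^T) = P *m B + e *m e^T.
  rewrite mulmxDl -(mulmxA (e - d)) bBa mulmxDr (mulmxA P) mulmxBl.
  by rewrite -addrA [d *m e^T + _]addrC subrK.
have eP' : e^T *m (P + (e - d) *m b) = b.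
  rewrite mulmxDr Greville_row add0r mulmxA mulmxBr e_unit.
  by rewrite (mulmxA e^T) Greville_row mul0mx subr0 mul1mx.
have PBP' : P *m B *m (P + (e - d) *m b) = P - d *m b.
  rewrite mulmxDr p2 mulmxA mulmxBr -(mulmxA P B e) Be mulmx0 sub0r.
  by rewrite Greville_proj mulNmx.
rewrite /penrose dom Greville_range; split.
- rewrite mulmxDl -(mulmxA u) bBa mulmxDr p1 (mulmxA (B *m P)).
  by rewrite -(mulmxA B P a) -addrA -mulmxDl [B *m d + _]addrC subrK.
- rewrite mulmxDl PBP' -(mulmxA e) eP' -addrA; congr (_ + _).
  by rewrite mulmxBl addrC.
- by rewrite raddfD /= p3 -scalemxAr linearZ /= trmx_mul trmxK.
- by rewrite raddfD /= p4 trmx_mul trmxK.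
Qed.

(** The new column is [B *m d], so [e - d] is a new direction of the kernel; the
    correction makes the columns of the result orthogonal to it. *)
Lemma Greville_dependent : u = 0 ->
  penrose (B + a *m e^T) (P + (e - d) *m ((1 + fdot d d)^-1 *: (d^T *m P))).
Proof.
move=> u0; have [p1 p2 p3 p4] := BP.
set g := 1 + fdot d d.
have g0 : g != 0 by rewrite lt0r_neq0// ltr_pwDl// fdot_ge0.
have aE : a = B *m d by apply/eqP; rewrite -subr_eq0 u0.
set b := _ *: _.
have bB : b *m B = g^-1 *: d^T.
  rewrite -scalemxAl; congr (_ *: _); apply: trmx_inj.
  by rewrite trmxK -mulmxA trmx_mul p4 trmxK Greville_proj.
have ba : b *m a = (1 - g^-1)%:M.
  rewrite [X in b *m X]aE (mulmxA b) bB -scalemxAl trmx_mul_cV.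
  rewrite scale_scalar_mx; congr _%:M.
  by rewrite -[fdot d d](addKr 1) -/g mulrDr mulVf// mulrN1 addrC.
have bBP : b *m (B *m P) = b.
  by rewrite -scalemxAl -mulmxA (mulmxA P) p2.
have bBa : b *m (B + a *m e^T) = g^-1 *: d^T + (1 - g^-1) *: e^T.
  by rewrite mulmxDr bB mulmxA ba mul_scalar_mx.
have dom : (P + (e - d) *m b) *m (B + a *m e^T) =
    P *m B + (g^-1 *: (e *m d^T) + g^-1 *: (d *m e^T)
      - g^-1 *: (d *m d^T) + (1 - g^-1) *: (e *m e^T)).
  rewrite mulmxDl -(mulmxA (e - d)) bBa mulmxDr (mulmxA P).
  rewrite mulmxDr -!scalemxAr !mulmxBl; move: (P *m B) => X.
  move: (e *m e^T) (e *m d^T) (d *m e^T) (d *m d^T) => X1 X2 X3 X4.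
  by apply/matrixP => i j; rewrite !mxE; ring.
rewrite /penrose Greville_range u0 mul0mx addr0; split.
- by rewrite mulmxDr p1 (mulmxA (B *m P)) -(mulmxA B P a) -aE.
- rewrite -mulmxA Greville_range u0 mul0mx addr0 mulmxDl mulmxA p2.
  by rewrite -(mulmxA (e - d)) bBP.
- exact: p3.
rewrite dom !linearD /= p4 !linearN /= !linearZ /= !trmx_mul !trmxK.
by congr (_ + (_ + _ + _)); rewrite addrC.
Qed.

End Greville.

(** * Programs compiled to computation trees *)

Section Programs.
Variables (I : Type) (c r : nat).

(** A program receives the number of results computed so far and a
    continuation, which receives the new number of results and the value
    returned. *)
Definition prog T := nat -> (nat -> T -> ctree I c r) -> ctree I c r.

Definition ret T (x : T) : prog T := fun h k => k h x.

Definition bind T T' (f : prog T) (g : T -> prog T') : prog T' :=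
  fun h k => f h (fun h' x => g x h' k).

Definition calc o a b : prog (operand I) :=
  fun h k => Compute o a b (k h.+1 (Reg h)).

Definition if_eq T a b (f g : prog T) : prog T :=
  fun h k => TestEq a b (f h k) (g h k).

Fixpoint tabulate (J : eqType) (s : seq J) (f : J -> prog (operand I)) :
    prog (J -> operand I) :=
  if s is j :: s' then
    bind (f j) (fun a => bind (tabulate s' f) (fun h =>
      ret (fun j' => if j' == j then a else h j')))
  else ret (fun=> Cst 0).

Definition mx_prog p q (f : 'I_p -> 'I_q -> prog (operand I)) :
    prog 'M[operand I]_(p, q) :=
  bind (tabulate (enum {: 'I_p * 'I_q}) (fun ij => f ij.1 ij.2)) (fun h =>
    ret (\matrix_(i, j) h (i, j))).

Fixpoint dot_prog (J : Type) (s : seq J) (a b : J -> operand I) :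
    prog (operand I) :=
  if s is j :: s' then
    bind (dot_prog s' a b) (fun x =>
    bind (calc Mul (a j) (b j)) (fun y => calc Add y x))
  else ret (Cst 0).

Definition mul_prog p n q (X : 'M[operand I]_(p, n)) (Y : 'M[operand I]_(n, q)) :=
  mx_prog (fun i j => dot_prog (enum 'I_n) (X i) (fun l => Y l j)).

(** One step of Greville's method: [P] is the pseudoinverse of [X] with the
    columns not treated so far replaced by 0, and column [j] is added.  The test
    decides between [Greville_dependent] and [Greville_independent]. *)
Definition greville_step s k (X : 'M[operand I]_(s, k)) (j : 'I_k)
    (P : 'M[operand I]_(k, s)) : prog 'M[operand I]_(k, s) :=
  bind (mul_prog P (col j X)) (fun d =>
  bind (mul_prog X d) (fun Xd =>
  bind (mx_prog (fun i o => calc Defs.Sub (X i j) (Xd i o))) (fun u =>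
  bind (dot_prog (enum 'I_s) (u^~ 0) (u^~ 0)) (fun uu =>
  bind (if_eq uu (Cst 0)
    (bind (dot_prog (enum 'I_k) (d^~ 0) (d^~ 0)) (fun dd =>
     bind (calc Add (Cst 1) dd) (fun g =>
     bind (mul_prog d^T P) (fun dP =>
     mx_prog (fun o i => calc Div (dP o i) g)))))
    (mx_prog (fun o i => calc Div (u i o) uu))) (fun b =>
  mx_prog (fun i l =>
    bind (calc Defs.Sub (Cst (i == j)) (d i 0)) (fun x =>
    bind (calc Mul x (b 0 l)) (fun y => calc Add (P i l) y)))))))).

Fixpoint greville s k (X : 'M[operand I]_(s, k)) (js : seq 'I_k)
    : prog 'M[operand I]_(k, s) :=
  if js is j :: js' then bind (greville X js') (greville_step X j)
  else ret (\matrix_(i, l) Cst 0).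

Definition pinv_prog s k (X : 'M[operand I]_(s, k)) := greville X (enum 'I_k).

End Programs.

Arguments ret {I c r T} x h k.
Arguments calc {I c r} o a b h k.
Arguments dot_prog {I c r J} s a b.
Arguments mul_prog {I c r p n q} X Y.
Arguments greville_step {I c r s k} X j P.
Arguments greville {I c r s k} X js.
Arguments pinv_prog {I c r s k} X.

Section Correctness.
Variables (R : realType) (I : Type) (c r : nat) (input : I -> R).
Local Notation prog := (prog I c r).

(** The quantifier over later results keeps operands usable after further
    computations. *)
Definition stable regs (a : operand I) v :=
  forall ext, operand_val input (regs ++ ext) a = v.

Definition stable_mx p q regs (X : 'M[operand I]_(p, q)) (A : 'M[R]_(p, q)) :=
  forall i j, stable regs (X i j) (A i j).

Definition charge k (res : option ('M[R]_(c, r) * nat)) :=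
  omap (fun x => (x.1, (x.2 + k)%N)) res.

(** A Hoare triple with a cost bound; its quantifier over continuations makes it
    compose ([achieves_bind]). *)
Definition achieves T (f : prog T) regs k (Q : seq R -> T -> Prop) :=
  exists ext x cost, [/\ (cost <= k)%N, Q (regs ++ ext) x &
    forall cont, run input (f (size regs) cont) regs =
      charge cost (run input (cont (size (regs ++ ext)) x) (regs ++ ext))].

Lemma stable_cat regs ext a v : stable regs a v -> stable (regs ++ ext) a v.
Proof. by move=> H e; rewrite -catA. Qed.

Lemma stable_mx_cat p q regs ext (X : 'M_(p, q)) A :
  stable_mx regs X A -> stable_mx (regs ++ ext) X A.
Proof. by move=> H i j; apply: stable_cat. Qed.

Lemma stable_Cst regs n : stable regs (Cst n) n%:R.
Proof. by []. Qed.

Lemma stable_In regs i : stable regs (In i) (input i).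
Proof. by []. Qed.

Lemma charge0 res : charge 0 res = res.
Proof. by case: res => // -[X k]; rewrite /charge /= addn0. Qed.

Lemma chargeD k l res : charge k (charge l res) = charge (l + k) res.
Proof. by case: res => // -[X n]; rewrite /charge /= addnA. Qed.

Lemma tick_charge res : tick res = charge 1 res.
Proof. by case: res => // -[X n]; rewrite /charge /= addn1. Qed.

Lemma achieves_leq T (f : prog T) regs k k' (Q : _ -> _ -> Prop) :
  (k <= k')%N -> achieves f regs k Q -> achieves f regs k' Q.
Proof.
move=> kk [ext [x [cost [ck q H]]]]; exists ext, x, cost; split=> //.
exact: leq_trans ck kk.
Qed.

Lemma achieves_ret T (x : T) regs (Q : _ -> _ -> Prop) :
  Q regs x -> achieves (ret x : prog T) regs 0 Q.
Proof.
by move=> q; exists [::], x, 0; split; rewrite ?cats0// => cont; rewrite charge0.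
Qed.

Lemma achieves_bind T T' (f : prog T) (g : T -> prog T') regs k l Q Q' :
    achieves f regs k Q ->
    (forall ext x, Q (regs ++ ext) x -> achieves (g x) (regs ++ ext) l Q') ->
  achieves (bind f g) regs (k + l) Q'.
Proof.
move=> [ext [x [cost [ck q H]]]] G.
have [ext' [x' [cost' [cl q' H']]]] := G _ _ q.
exists (ext ++ ext'), x', (cost' + cost)%N; rewrite catA; split=> //.
  by rewrite addnC leq_add.
by move=> cont; rewrite /bind H H' chargeD.
Qed.

Lemma achieves_calc o a b va vb v regs :
    stable regs a va -> stable regs b vb -> arith_val o va vb = Some v ->
  achieves (calc o a b : prog _) regs 1 (fun regs x => stable regs x v).
Proof.
move=> Ha Hb E; exists [:: v], (Reg (size regs)), 1; split=> //.
  by move=> ext; rewrite /= -catA nth_cat ltnn subnn.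
move=> cont; have := Ha [::]; have := Hb [::]; rewrite cats0 => vbE vaE.
by rewrite /calc /= vaE vbE E tick_charge size_cat addn1 cats1.
Qed.

Lemma achieves_if_eq T a b va vb (f g : prog T) regs k Q :
    stable regs a va -> stable regs b vb ->
    (va = vb -> achieves f regs k Q) -> (va <> vb -> achieves g regs k Q) ->
  achieves (if_eq a b f g) regs k.+1 Q.
Proof.
move=> /(_ [::]) + /(_ [::]); rewrite cats0 => Ha Hb Hf Hg.
have [E|E] := eqVneq va vb.
  have [ext [x [cost [ck q H]]]] := Hf E; exists ext, x, cost.+1; split=> //.
  by move=> cont; rewrite /if_eq /= Ha Hb E eqxx H tick_charge chargeD addn1.
have [ext [x [cost [ck q H]]]] := Hg (elimN eqP E).
exists ext, x, cost.+1; split=> // cont.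
by rewrite /if_eq /= Ha Hb (negPf E) H tick_charge chargeD addn1.
Qed.

Lemma achieves_tabulate (J : eqType) (s : seq J) (f : J -> prog (operand I))
    (v : J -> R) regs k :
    (forall j ext, achieves (f j) (regs ++ ext) k
       (fun regs x => stable regs x (v j))) ->
  achieves (tabulate s f) regs (size s * k)
    (fun regs h => forall j, j \in s -> stable regs (h j) (v j)).
Proof.
elim: s regs => [|j s IH] regs Hf /=; first exact: achieves_ret.
rewrite mulSn; apply: achieves_bind.
  by move: (Hf j [::]); rewrite cats0; exact.
move=> ext a Ha; rewrite -[(size s * k)%N]addn0; apply: achieves_bind.
  by apply: IH => i ext'; rewrite -catA; apply: Hf.
move=> ext' h Hh; apply: achieves_ret => i; rewrite in_cons.
have [->|_] := eqVneq i j => [_|/Hh //]; exact: stable_cat.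
Qed.

Lemma achieves_mx p q (f : 'I_p -> 'I_q -> prog (operand I)) (A : 'M[R]_(p, q))
    regs k :
    (forall i j ext, achieves (f i j) (regs ++ ext) k
       (fun regs x => stable regs x (A i j))) ->
  achieves (mx_prog f) regs (p * q * k) (fun regs X => stable_mx regs X A).
Proof.
move=> Hf; rewrite -[(p * q * k)%N]addn0; apply: achieves_bind.
  have -> : (p * q)%N = size (enum {: 'I_p * 'I_q}).
    by rewrite -cardE card_prod !card_ord.
  apply: (@achieves_tabulate _ _ _ (fun ij => A ij.1 ij.2)) => -[i j] ext.
  exact: Hf.
move=> ext h Hh; apply: achieves_ret => i j; rewrite mxE.
by apply: (Hh (i, j)); rewrite mem_enum.
Qed.

Lemma achieves_dot (J : Type) (s : seq J) a b (va vb : J -> R) regs :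
    (forall j, stable regs (a j) (va j)) ->
    (forall j, stable regs (b j) (vb j)) ->
  achieves (dot_prog s a b : prog _) regs (2 * size s)
    (fun regs x => stable regs x (\sum_(j <- s) va j * vb j)).
Proof.
move=> Ha Hb; elim: s => [|j s IH] /=.
  by apply: achieves_ret; rewrite big_nil.
rewrite mulnS addnC; apply: achieves_bind IH _ => ext x Hx.
apply: (achieves_bind (k := 1) (l := 1)).
  by apply: achieves_calc => //; apply: stable_cat.
move=> ext' y Hy; rewrite big_cons; apply: achieves_calc => //.
exact: stable_cat.
Qed.

Lemma achieves_mul p n q (X : 'M_(p, n)) (Y : 'M_(n, q)) A B regs :
    stable_mx regs X A -> stable_mx regs Y B ->
  achieves (mul_prog X Y : prog _) regs (p * q * (2 * n))
    (fun regs Z => stable_mx regs Z (A *m B)).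
Proof.
move=> HX HY; apply: achieves_mx => i j ext.
rewrite -[X in (2 * X)%N]card_ord cardE.
rewrite mxE -big_enum; apply: achieves_dot => l; apply: stable_cat.
  exact: HX.
exact: HY.
Qed.

Section GrevilleCorrect.
Variables (s k : nat) (B : 'M[R]_(s, k)).

Definition mask_cols (js : seq 'I_k) : 'M[R]_(s, k) :=
  \matrix_(i, j) (if j \in js then B i j else 0).

Lemma mask_cols_nil : mask_cols [::] = 0.
Proof. by apply/matrixP => i j; rewrite !mxE. Qed.

Lemma mask_cols_enum : mask_cols (enum 'I_k) = B.
Proof. by apply/matrixP => i j; rewrite !mxE mem_enum. Qed.

Variables (j : 'I_k) (js : seq 'I_k).
Hypothesis j_new : j \notin js.
Local Notation e := (delta_mx j 0 : 'cV[R]_k).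
Local Notation B' := (mask_cols js).
Local Notation d := (pinv B' *m col j B).

Lemma mask_cols_cons : mask_cols (j :: js) = B' + col j B *m e^T.
Proof.
apply/matrixP => i l; rewrite !mxE big_ord1 !mxE in_cons eqxx andbT.
have [->|_] := eqVneq l j; first by rewrite (negPf j_new) add0r mulr1.
by rewrite mulr0 addr0.
Qed.

Lemma mask_cols_delta l : l \notin js -> B' *m (delta_mx l 0 : 'cV_k) = 0.
Proof.
by move=> ljs; rewrite -colE; apply/matrixP => i o; rewrite !mxE (negPf ljs).
Qed.

Lemma delta_mx_unit : e^T *m e = 1%:M.
Proof.
rewrite trmx_delta mul_delta_mx; apply/matrixP => i o.
by rewrite !ord1 !mxE !eqxx.
Qed.

(** The entries of [d] outside [js] vanish, so [greville_step] may multiply by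
    the whole of [X]. *)
Lemma mask_cols_mul : B' *m d = B *m d.
Proof.
apply/matrixP => i o; rewrite !mxE; apply: eq_bigr => l _; rewrite mxE.
case: ifPn => // ljs; rewrite mul0r; apply/esym/eqP; rewrite mulf_eq0.
apply/orP; right; apply/eqP.
have := Greville_row (pinvP B') (mask_cols_delta ljs).
rewrite trmx_delta -rowE => row0.
transitivity ((row l (pinv B') *m col j B) 0 o); last by rewrite row0 mul0mx mxE.
by rewrite -row_mul [RHS]mxE.
Qed.

Lemma pinv_mask_cons b :
    let u := col j B - B *m d in
    (u = 0 -> b = (1 + fdot d d)^-1 *: (d^T *m pinv B')) ->
    (u <> 0 -> b = (fdot u u)^-1 *: u^T) ->
  pinv (mask_cols (j :: js)) = pinv B' + (e - d) *m b.
Proof.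
rewrite /= -mask_cols_mul => b0 b1; rewrite mask_cols_cons; apply: pinv_eq.
have := delta_mx_unit; have := mask_cols_delta j_new; have := pinvP B'.
have [u0|u0] := eqVneq (col j B - B' *m d) 0 => pB Be ee.
  rewrite b0//; exact: Greville_dependent.
rewrite (b1 (elimN eqP u0)); exact: Greville_independent.
Qed.

Lemma sum_fdot n (x y : 'cV[R]_n) :
  \sum_(i <- enum 'I_n) x i 0 * y i 0 = fdot x y.
Proof. by rewrite fdotE big_enum; apply: eq_bigr => i _; rewrite big_ord1. Qed.

Lemma achieves_greville_step (X : 'M[operand I]_(s, k)) P regs :
    stable_mx regs X B -> stable_mx regs P (pinv B') ->
  achieves (greville_step X j P : prog _) regs (9 * (s * k) + 4 * s + 2 * k + 2)
    (fun regs Y => stable_mx regs Y (pinv (mask_cols (j :: js)))).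
Proof.
move=> HX HP; set u := col j B - B *m d.
pose b : 'M[R]_(1, s) := if u == 0 then (1 + fdot d d)^-1 *: (d^T *m pinv B')
  else (fdot u u)^-1 *: u^T.
have -> : pinv (mask_cols (j :: js)) = pinv B' + (e - d) *m b.
  apply: pinv_mask_cons => /eqP u0; rewrite /b; first by rewrite u0.
  by rewrite (negPf u0).
apply: (@achieves_leq _ _ _ (k * 1 * (2 * s) + (s * 1 * (2 * k) + (s * 1 * 1 +
  (2 * size (enum 'I_s) + ((2 * size (enum 'I_k) + (1 + (1 * s * (2 * k) +
  1 * s * 1))).+1 + k * s * (1 + (1 + 1)))))))).
  by rewrite -!cardE !card_ord; nia.
have Hcol : stable_mx regs (col j X) (col j B).
  by move=> i o; rewrite !mxE; apply: HX.
apply: achieves_bind (achieves_mul HP Hcol) _ => e1 dX Hd.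
apply: achieves_bind (achieves_mul (stable_mx_cat e1 HX) Hd) _ => e2 XdX HXd.
apply: (achieves_bind (Q := fun regs Y => stable_mx regs Y u)).
  apply: achieves_mx => i o ext; apply: achieves_calc.
  - by do 3!apply: stable_cat; apply: HX.
  - by apply: stable_cat; apply: HXd.
  - by rewrite !mxE.
move=> e3 uX Hu.
apply: (achieves_bind (Q := fun regs x => stable regs x (fdot u u))).
  by rewrite -sum_fdot; apply: achieves_dot => i; apply: Hu.
move=> e4 uuX Huu.
have Hd' : stable_mx ((((regs ++ e1) ++ e2) ++ e3) ++ e4) dX d.
  by do 3!apply: stable_mx_cat.
have HP' : stable_mx ((((regs ++ e1) ++ e2) ++ e3) ++ e4) P (pinv B').
  by do 4!apply: stable_mx_cat.
apply: (achieves_bind (Q := fun regs Y => stable_mx regs Y b)).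
  apply: (achieves_if_eq Huu (stable_Cst _ 0)) => [/eqP|/eqP].
    rewrite fdot_eq0 /b => ->.
    apply: (achieves_bind (Q := fun regs x => stable regs x (fdot d d))).
      by rewrite -sum_fdot; apply: achieves_dot => i; apply: Hd'.
    move=> e5 ddX Hdd.
    apply: (achieves_bind (Q := fun regs x => stable regs x (1 + fdot d d))).
      exact: (achieves_calc (stable_Cst _ 1) Hdd).
    move=> e6 gX Hg.
    have HdT : stable_mx ((((((regs ++ e1) ++ e2) ++ e3) ++ e4) ++ e5) ++ e6)
        dX^T d^T.
      move=> i o; rewrite [dX^T _ _]mxE [d^T _ _]mxE.
      by do 2!apply: stable_cat; apply: Hd'.
    have HP2 := stable_mx_cat e6 (stable_mx_cat e5 HP').
    apply: achieves_bind (achieves_mul HdT HP2) _ => e7 dPX HdP.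
    apply: achieves_mx => o i ext; apply: achieves_calc.
    - by apply: stable_cat; apply: HdP.
    - by do 2!apply: stable_cat; apply: Hg.
    - rewrite /= gt_eqF ?ltr_pwDl ?fdot_ge0// [in RHS]mxE; congr Some.
      exact: mulrC.
  rewrite fdot_eq0 /b => u0; rewrite (negPf u0).
  apply: (@achieves_leq _ _ _ (1 * s * 1)); first lia.
  apply: achieves_mx => o i ext; apply: achieves_calc.
  - by do 2!apply: stable_cat; apply: Hu.
  - by apply: stable_cat; apply: Huu.
  - by rewrite /= fdot_eq0 (negPf u0) ord1 !mxE mulrC.
move=> e5 bX Hb; apply: achieves_mx => i l ext.
apply: (achieves_bind (Q := fun regs x => stable regs x ((e - d) i 0))).
  apply: achieves_calc (stable_Cst _ (i == j)) (_ : stable _ _ (d i 0)) _.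
    by do 2!apply: stable_cat; apply: Hd'.
  by rewrite !mxE eqxx andbT.
move=> e6 xX Hx.
apply: (achieves_bind (Q := fun regs x => stable regs x ((e - d) i 0 * b 0 l))).
  by apply: achieves_calc Hx _ _ => //; do 2!apply: stable_cat; apply: Hb.
move=> e7 yX Hy.
apply: achieves_calc _ Hy _ => //; first by do 4!apply: stable_cat; apply: HP'.
by rewrite /= [in RHS]mxE; congr (Some (_ + _)); rewrite [RHS]mxE big_ord1.
Qed.

End GrevilleCorrect.

Lemma achieves_greville s k (B : 'M[R]_(s, k)) (X : 'M[operand I]_(s, k)) js
    regs :
    stable_mx regs X B -> uniq js ->
  achieves (greville X js : prog _) regs
    (size js * (9 * (s * k) + 4 * s + 2 * k + 2))
    (fun regs Y => stable_mx regs Y (pinv (mask_cols B js))).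
Proof.
move=> HX; elim: js => [_|j js IH] /=.
  apply: achieves_ret => i l; rewrite !mxE mask_cols_nil.
  have -> : pinv (0 : 'M[R]_(s, k)) = 0.
    by apply: pinv_eq; split; rewrite ?mulmx0 ?mul0mx ?trmx0.
  by rewrite mxE; apply: stable_Cst.
case/andP=> j_new /IH{}IH; rewrite mulSn addnC.
apply: achieves_bind IH _ => ext P HP.
by apply: achieves_greville_step => //; apply: stable_mx_cat.
Qed.

Lemma achieves_pinv s k (B : 'M[R]_(s, k)) (X : 'M[operand I]_(s, k)) regs :
    stable_mx regs X B ->
  achieves (pinv_prog X : prog _) regs (k * (9 * (s * k) + 4 * s + 2 * k + 2))
    (fun regs Y => stable_mx regs Y (pinv B)).
Proof.
move=> HX; have := achieves_greville HX (enum_uniq 'I_k).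
by rewrite -cardE card_ord mask_cols_enum.
Qed.

End Correctness.

Section SketchedSolver.
Variables (m n c r sc sr : nat).
Local Notation coord := (gmr_coord m n c r sc sr).
Local Notation prog := (prog coord c r).

(** Row [h] of a sketched matrix is a multiple of the row picked at step [h], so
    forming the sketched matrices costs at most two operations per entry.  The
    sketched [N] is handled through its transpose, which has [r] columns, so
    that its pseudoinverse takes only [r] steps. *)
Definition solver : prog 'M[operand coord]_(c, r) :=
  bind (mx_prog (fun h k =>
    calc Mul (In (InSM h (inr h))) (In (InM (inr h) k)))) (fun SMM =>
  bind (mx_prog (fun h k =>
    calc Mul (In (InSN h (inr h))) (In (InN k (inr h))))) (fun SNN =>
  bind (mx_prog (fun h h' =>
    bind (calc Mul (In (InSM h (inr h))) (In (InA (inr h) (inr h')))) (fun x =>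
    calc Mul (In (InSN h' (inr h'))) x))) (fun SASN =>
  bind (pinv_prog SMM) (fun PM =>
  bind (pinv_prog SNN) (fun PN =>
  bind (mul_prog PM SASN) (fun Y => mul_prog Y PN^T)))))).

Definition solver_tree : ctree coord c r := solver 0 (fun _ X => Return X).

Variables (R : realType) (A : 'M[R]_(m, n)) (M : 'M[R]_(m, c)) (N : 'M[R]_(r, n)).
Variables (VM : 'M[R]_(m, c)) (VN : 'M[R]_(n, r)).
Variables (wM : picks m sc) (wN : picks n sr).
Local Notation SM := (sketch VM wM).
Local Notation SN := (sketch VN wN).
Local Notation input := (gmr_input A M N SM SN wM wN).

Lemma achieves_solver : (0 < c)%N -> (0 < sc)%N -> (0 < r)%N -> (0 < sr)%N ->
  achieves input solver [::]
    (18 * (c ^ 2 * sc + r ^ 2 * sr) + 4 * (c * sc * sr) + 2 * (c * r * sr))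
    (fun regs X => stable_mx input regs X (Xhat SM SN A M N)).
Proof.
move=> c0 sc0 r0 sr0.
apply: (@achieves_leq _ _ _ _ _ _ _ _ (sc * c * 1 + (sr * r * 1 +
  (sc * sr * (1 + 1) + (c * (9 * (sc * c) + 4 * sc + 2 * c + 2) +
  (r * (9 * (sr * r) + 4 * sr + 2 * r + 2) + (c * sr * (2 * sc) +
  c * r * (2 * sr)))))))).
  have lin k s : (0 < k)%N -> (0 < s)%N -> (s * k * 1 +
      k * (9 * (s * k) + 4 * s + 2 * k + 2) <= 18 * (k ^ 2 * s))%N.
    move=> k0 s0; have : (s * k <= k ^ 2 * s)%N by nia.
    have : (k ^ 2 <= k ^ 2 * s)%N by nia.
    have : (k <= k ^ 2 * s)%N by nia.
    have -> : (k * (9 * (s * k) + 4 * s + 2 * k + 2) =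
      9 * (k ^ 2 * s) + 4 * (s * k) + 2 * k ^ 2 + 2 * k)%N by nia.
    lia.
  have := lin _ _ c0 sc0; have := lin _ _ r0 sr0.
  have : (sc * sr <= c * sc * sr)%N by nia.
  have : (c * sr * (2 * sc) = 2 * (c * sc * sr))%N by nia.
  have : (c * r * (2 * sr) = 2 * (c * r * sr))%N by nia.
  have : (sc * sr * (1 + 1) = 2 * (sc * sr))%N by nia.
  lia.
apply: (achieves_bind (Q := fun regs X => stable_mx input regs X (SM *m M))).
  apply: achieves_mx => h k ext.
  apply: achieves_calc (stable_In _ _ _) (stable_In _ _ _) _.
  by rewrite /= mul_sketch.
move=> e1 SMM HM.
apply: (achieves_bind (Q := fun regs X => stable_mx input regs X (SN *m N^T))).
  apply: achieves_mx => h k ext.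
  apply: achieves_calc (stable_In _ _ _) (stable_In _ _ _) _.
  by rewrite /= mul_sketch [N^T _ _]mxE.
move=> e2 SNN HN.
apply: (achieves_bind
  (Q := fun regs X => stable_mx input regs X (SM *m A *m SN^T))).
  apply: achieves_mx => h h' ext.
  apply: (achieves_bind
    (Q := fun regs x => stable input regs x ((SM *m A) h (wN h')))).
    apply: achieves_calc (stable_In _ _ _) (stable_In _ _ _) _.
    by rewrite /= mul_sketch.
  move=> e3 x Hx; apply: achieves_calc (stable_In _ _ _) Hx _ => /=.
  rewrite -[SM *m A *m SN^T]trmxK trmx_mul trmxK [_^T h h']mxE.
  by rewrite (mul_sketch VN) [_^T _ h]mxE.
move=> e3 SASN HA.
apply: achieves_bind (achieves_pinv c r (stable_mx_cat e3 (stable_mx_cat e2 HM))) _.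
move=> e4 PM HPM.
apply: achieves_bind (achieves_pinv c r (stable_mx_cat e4 (stable_mx_cat e3 HN))) _.
move=> e5 PN HPN.
apply: achieves_bind (achieves_mul c r (stable_mx_cat e5 HPM)
  (stable_mx_cat e5 (stable_mx_cat e4 HA))) _ => e6 Y HY.
have HPNT : stable_mx input ((((((([::] ++ e1) ++ e2) ++ e3) ++ e4) ++ e5)) ++ e6)
    PN^T (pinv (N *m SN^T)).
  move=> i j; rewrite -[N *m _]trmxK pinv_tr trmx_mul trmxK.
  rewrite [PN^T _ _]mxE [(pinv _)^T _ _]mxE.
  by apply: stable_cat; apply: HPN.
have -> : Xhat SM SN A M N =
    pinv (SM *m M) *m (SM *m A *m SN^T) *m pinv (N *m SN^T).
  by rewrite /Xhat !mulmxA.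
exact: (achieves_mul c r HY HPNT).
Qed.

Lemma run_solver : (0 < c)%N -> (0 < sc)%N -> (0 < r)%N -> (0 < sr)%N ->
  exists cost, run input solver_tree [::] = Some (Xhat SM SN A M N, cost) /\
    (cost <= 18 * (c ^ 2 * sc + r ^ 2 * sr) + 4 * (c * sc * sr) +
      2 * (c * r * sr))%N.
Proof.
move=> c0 sc0 r0 sr0.
have [ext [X [cost [cost_le HX run_eq]]]] := achieves_solver c0 sc0 r0 sr0.
exists cost; split=> //; rewrite /solver_tree (run_eq (fun _ X => Return X)) /=.
rewrite add0n; congr (Some (_, _)); apply/matrixP => i j; rewrite mxE.
by have := HX i j [::]; rewrite cats0.
Qed.

End SketchedSolver.

(** * Sample sizes, cost and conclusion *)

Section SampleSize.
Variable R : realType.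

Lemma ln2_ge : 1 / 2 <= ln 2 :> R.
Proof.
rewrite -ler_expR lnK ?posrE// -[1 / 2]opprK expRN -[leRHS]invrK.
rewrite lef_pV2 ?posrE ?expR_gt0 ?invr_gt0//.
by apply: le_trans (expR_ge1Dx _); lra.
Qed.

Lemma trunc_log_le_ln k : (0 < k)%N -> (trunc_log 2 k)%:R <= 2 * ln k%:R :> R.
Proof.
move=> k_gt0; set t := trunc_log 2 k.
have le_k : ln (2 ^+ t) <= ln k%:R :> R.
  rewrite ler_ln ?posrE ?exprn_gt0 ?ltr0n// -natrX ler_nat.
  exact: trunc_logP.
rewrite lnXn// -[ln 2 *+ t]mulr_natl in le_k.
have := ler_wpM2l (ler0n R t) ln2_ge; lra.
Qed.

(** The bound by [eta] is for the smallest eigenvalue, where the potential needs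
    an exponent [q.*2] of order [ln k]; the bound by [theta * eps] is for the
    second moments. *)
Lemma sample_size (theta eta eps : R) k :
    0 < theta -> 0 < eta -> 0 < eps < 1 -> (0 < k)%N ->
  exists s q : nat, [/\ (0 < s)%N, (0 < q)%N, (k <= 2 ^ q.*2)%N,
    2 * (q.*2)%:R * (k%:R / s%:R) <= eta & k%:R / s%:R <= theta * eps] /\
    s%:R <= (theta^-1 + 8 / eta + 1) * (k%:R / eps + k%:R * ln k%:R).
Proof.
move=> theta_gt0 eta_gt0 /andP[eps_gt0 eps_lt1] k_gt0.
set q := (trunc_log 2 k).+1.
set x : R := k%:R / (theta * eps) + 4 * q%:R * k%:R / eta.
have k_ge1 : 1 <= k%:R :> R by rewrite (ler_nat R 1).
have x1_ge0 : 0 <= k%:R / (theta * eps) by rewrite divr_ge0// mulr_ge0// ltW.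
have x2_ge0 : 0 <= 4 * q%:R * k%:R / eta by rewrite divr_ge0 ?mulr_ge0// ltW.
have x_ge0 : 0 <= x by rewrite addr_ge0.
set s := (Num.truncn x).+1; exists s, q.
have s_gt : x < s%:R by rewrite truncnS_gt.
have s_le : s%:R <= x + 1 by rewrite -natr1 lerD2r truncn_le.
have s_gt0 : 0 < s%:R :> R by rewrite ltr0n.
split; first split=> //.
- apply: ltnW (leq_trans (trunc_log_ltn k (isT : (1 < 2)%N)) _).
  by rewrite leq_exp2l// -addnn leq_addr.
- rewrite mulrA ler_pdivrMr// mulrC -ler_pdivrMl//.
  rewrite -addnn natrD; apply: le_trans (ltW s_gt).
  apply: le_trans (_ : 4 * q%:R * k%:R / eta <= _); last by rewrite lerDr.
  by rewrite le_eqVlt; apply/orP; left; apply/eqP; field; rewrite lt0r_neq0.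
- rewrite ler_pdivrMr// mulrC -ler_pdivrMr ?mulr_gt0//.
  by apply: le_trans (ltW s_gt); rewrite lerDl.
apply: (le_trans s_le).
have q_le : q%:R <= 2 * ln k%:R + 1 :> R.
  have -> : q%:R = (trunc_log 2 k)%:R + 1 :> R by rewrite natr1.
  by rewrite lerD2r trunc_log_le_ln.
have ln_ge0 : 0 <= ln k%:R :> R by rewrite ln_ge0.
have keps : k%:R <= k%:R / eps by rewrite ler_peMr// invf_ge1// ltW.
have eta_inv : 0 <= eta^-1 by rewrite invr_ge0 ltW.
have theta_inv : 0 <= theta^-1 by rewrite invr_ge0 ltW.
have x1E : k%:R / (theta * eps) = theta^-1 * (k%:R / eps).
  by field; rewrite !lt0r_neq0.
have x2_le : 4 * q%:R * k%:R / eta <=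
    8 / eta * (k%:R / eps + k%:R * ln k%:R).
  have -> : 4 * q%:R * k%:R / eta = eta^-1 * (4 * (k%:R * q%:R)).
    by field; rewrite lt0r_neq0.
  have -> : 8 / eta * (k%:R / eps + k%:R * ln k%:R) =
      eta^-1 * (8 * (k%:R / eps + k%:R * ln k%:R)) by field; rewrite !lt0r_neq0.
  rewrite ler_wpM2l//; have := ler_wpM2l (ler0n R k) q_le.
  move: keps k_ge1; lra.
have kln_ge0 : 0 <= k%:R * ln k%:R :> R by rewrite mulr_ge0.
have := mulr_ge0 theta_inv kln_ge0.
move: x2_le; rewrite /x x1E; lra.
Qed.

(** [E] stands for [1 / eps] and [lc], [lr] for the logarithms. *)
Lemma solver_cost (C E lc lr : R) (c r sc sr : nat) :
    0 < C -> 1 <= E -> 0 <= lc -> 0 <= lr -> (0 < c)%N -> (0 < r)%N ->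
    sc%:R <= C * (c%:R * (E + lc)) -> sr%:R <= C * (r%:R * (E + lr)) ->
  (18 * (c ^ 2 * sc + r ^ 2 * sr) + 4 * (c * sc * sr) + 2 * (c * r * sr))%:R <=
    (18 * C + 4 * C ^+ 2 + 2 * C) *
      ((c ^ 2 * r + c * r ^ 2)%:R * (E ^+ 2 + (lc + lr) * E + lc * lr) +
       (c ^ 3 + r ^ 3)%:R * E + c%:R ^+ 3 * lc + r%:R ^+ 3 * lr).
Proof.
move=> C0 E1 lc0 lr0 c0 r0 sc_le sr_le.
have E0 : 0 <= E by apply: le_trans E1.
have c1 : 1 <= c%:R :> R by rewrite (ler_nat R 1).
have r1 : 1 <= r%:R :> R by rewrite (ler_nat R 1).
rewrite !(natrD, natrM, natrX).
move: sc_le sr_le (ler0n R sc) (ler0n R sr) c1 r1.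
move: (c%:R : R) (r%:R : R) (sc%:R : R) (sr%:R : R) => x y a b.
move=> a_le b_le a0 b0 x1 y1.
have x0 : 0 <= x by apply: le_trans x1.
have y0 : 0 <= y by apply: le_trans y1.
have cubic (z s l : R) : 0 <= z -> s <= C * (z * (E + l)) ->
    z ^+ 2 * s <= C * (z ^+ 3 * E + z ^+ 3 * l).
  move=> z0 H; apply: le_trans (ler_wpM2l (sqr_ge0 z) H) _.
  by rewrite le_eqVlt; apply/orP; left; apply/eqP; ring.
have ha := cubic _ _ _ x0 a_le; have hb := cubic _ _ _ y0 b_le.
set S := E ^+ 2 + (lc + lr) * E + lc * lr.
set T := x ^+ 3 * E + x ^+ 3 * lc + (y ^+ 3 * E + y ^+ 3 * lr).
have T0 : 0 <= T by rewrite !addr_ge0// mulr_ge0// exprn_ge0.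
have S0 : 0 <= S by rewrite !addr_ge0// ?mulr_ge0// ?addr_ge0// sqr_ge0.
have Q0 : 0 <= x ^+ 2 * y + x * y ^+ 2 by rewrite addr_ge0// mulr_ge0// sqr_ge0.
have hab : x * a * b <= C ^+ 2 * ((x ^+ 2 * y + x * y ^+ 2) * S).
  apply: (@le_trans _ _ (x * (C * (x * (E + lc)) * (C * (y * (E + lr)))))).
    by rewrite -mulrA ler_wpM2l// ler_pM.
  have -> : x * (C * (x * (E + lc)) * (C * (y * (E + lr)))) =
      C ^+ 2 * (x ^+ 2 * y * S) by rewrite /S; ring.
  by rewrite ler_wpM2l ?sqr_ge0// ler_wpM2r// lerDl mulr_ge0// sqr_ge0.
have hb2 : x * y * b <= C * ((x ^+ 2 * y + x * y ^+ 2) * S).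
  apply: (@le_trans _ _ (x * y * (C * (y * (E + lr))))).
    by rewrite ler_wpM2l// mulr_ge0.
  have -> : x * y * (C * (y * (E + lr))) = C * (x * y ^+ 2 * (E + lr)) by ring.
  rewrite ler_wpM2l ?(ltW C0)//; apply: ler_pM.
  - by rewrite mulr_ge0// sqr_ge0.
  - by rewrite addr_ge0.
  - by rewrite lerDr mulr_ge0// sqr_ge0.
  rewrite /S; have : E <= E ^+ 2 by rewrite expr2 ler_peMl.
  have : lr <= lr * E by rewrite ler_peMr.
  have := mulr_ge0 lc0 E0; have := mulr_ge0 lc0 lr0; lra.
set Q := (_ * S) in hab hb2 *.
have Q1 : 0 <= Q by rewrite mulr_ge0.
have C2T := mulr_ge0 (sqr_ge0 C) T0; have CT := mulr_ge0 (ltW C0) T0.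
have CQ := mulr_ge0 (ltW C0) Q1.
have -> : Q + (x ^+ 3 + y ^+ 3) * E + x ^+ 3 * lc + y ^+ 3 * lr = Q + T.
  by rewrite /T; ring.
have : 18 * (x ^+ 2 * a + y ^+ 2 * b) <= 18 * (C * T) by rewrite /T; lra.
move: hab hb2; lra.
Qed.

End SampleSize.

Theorem theorem7 (R : realType) (delta : R) (delta01 : 0 < delta < 1) :
  exists C K : R, [/\ 0 < C, 0 < K &
    forall (eps : R) (c r : nat), 0 < eps < 1 -> (1 <= c)%N -> (1 <= r)%N ->
    exists sc sr : nat,
      [/\ (0 < sc)%N, (0 < sr)%N,
          sc%:R <= C * (c%:R / eps + c%:R * ln c%:R),
          sr%:R <= C * (r%:R / eps + r%:R * ln r%:R) &
      forall m n : nat, (c < m)%N -> (r < n)%N ->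
      (forall (A : 'M[R]_(m, n)) (M : 'M[R]_(m, c)) (N : 'M[R]_(r, n))
         (VM : 'M[R]_(m, c)) (VN : 'M[R]_(n, r)),
         \rank M = c -> \rank N = r ->
         orthonormal_colbasis M VM -> orthonormal_colbasis N^T VN ->
         (forall X : 'M[R]_(c, r),
            residual A M N (Xstar A M N) <= residual A M N X) /\
         1 - delta <=
           Pr2 VM VN (fun (wM : picks m sc) (wN : picks n sr) =>
             residual A M N (Xhat (sketch VM wM) (sketch VN wN) A M N)
               <= (1 + eps) * residual A M N (Xstar A M N))) /\
      (exists T : ctree (gmr_coord m n c r sc sr) c r,
         forall (A : 'M[R]_(m, n)) (M : 'M[R]_(m, c)) (N : 'M[R]_(r, n))
           (VM : 'M[R]_(m, c)) (VN : 'M[R]_(n, r))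
           (wM : picks m sc) (wN : picks n sr),
         \rank M = c -> \rank N = r ->
         orthonormal_colbasis M VM -> orthonormal_colbasis N^T VN ->
         exists cost : nat,
           run (gmr_input A M N (sketch VM wM) (sketch VN wN) wM wN) T [::]
             = Some (Xhat (sketch VM wM) (sketch VN wN) A M N, cost) /\
           cost%:R <= K * gmr_cost eps c r (nnz M) (nnz N))]].
Proof.
have /andP[delta_gt0 delta_lt1] := delta01.
have delta01' : 0 < delta <= 1 by rewrite delta_gt0 ltW.
pose eta := (delta / 4) ^+ 2 / 192; pose theta := delta * eta ^+ 4 / 4.
have eta_pos : 0 < eta := eta_gt0 delta01'.
have theta_pos : 0 < theta := theta_gt0 delta01'.
pose C := theta^-1 + 8 / eta + 1.
have C_gt0 : 0 < C.
  have := divr_gt0 (ltr0n R 8) eta_pos; have : 0 < theta^-1 by rewrite invr_gt0.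
  rewrite /C; lra.
pose K := 18 * C + 4 * C ^+ 2 + 2 * C.
have K_gt0 : 0 < K by have := exprn_gt0 2 C_gt0; rewrite /K; lra.
exists C, K; split=> // eps c r eps01 c_gt0 r_gt0.
have [sc [qc [[sc_gt0 qc_gt0 c_le sc_large sc_eps] sc_le]]] :=
  sample_size theta_pos eta_pos eps01 c_gt0.
have [sr [qr [[sr_gt0 qr_gt0 r_le sr_large sr_eps] sr_le]]] :=
  sample_size theta_pos eta_pos eps01 r_gt0.
exists sc, sr; split=> // m n _ _; split.
  move=> A M N VM VN rankM rankN [VM_orth spanM] [VN_orth spanN].
  have [TM TM_unit ->] := orthonormal_colbasis_factor rankM spanM.
  rewrite -mxrank_tr in rankN.
  have [TN TN_unit NE] := orthonormal_colbasis_factor rankN spanN.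
  rewrite -[N]trmxK NE; split; first by move=> X; apply: residual_Xstar_le.
  exact: (success_probability A VM_orth VN_orth TM_unit TN_unit delta01' eps01
    c_gt0 r_gt0 sc_gt0 sr_gt0 qc_gt0 qr_gt0 c_le r_le).
exists (solver_tree m n c r sc sr) => A M N VM VN wM wN _ _ _ _.
have [cost [runE cost_le]] :=
  run_solver A M N VM VN wM wN c_gt0 sc_gt0 r_gt0 sr_gt0.
exists cost; split=> //; have /andP[eps_gt0 eps_lt1] := eps01.
have ln_ge0' k : (0 < k)%N -> 0 <= ln k%:R :> R.
  by move=> k_gt0; rewrite ln_ge0// (ler_nat R 1).
have E_ge1 : 1 <= eps^-1 by rewrite invf_ge1// ltW.
have sizeE (s k : nat) : s%:R <= C * (k%:R / eps + k%:R * ln k%:R) ->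
  s%:R <= C * (k%:R * (eps^-1 + ln k%:R)) by rewrite [k%:R * (_ + _)]mulrDr.
rewrite -(ler_nat R) in cost_le; apply: (le_trans cost_le).
apply: le_trans (solver_cost C_gt0 E_ge1 (ln_ge0' _ c_gt0) (ln_ge0' _ r_gt0)
  c_gt0 r_gt0 (sizeE _ _ sc_le) (sizeE _ _ sr_le)) _.
rewrite ler_pM2l// /gmr_cost natrM lnM ?posrE ?ltr0n// -exprVn.
have := ler0n R (nnz M); have := ler0n R (nnz N).
lra.
Qed.
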